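(* Let $A \in \mathbb{C}^{M \times N}$ and let $A_r$, $\operatorname{rank} A_r = r$, be the rank-$r$ truncated singular value decomposition of $A$. Then, using one singular value decomposition and therefore in $O(\min(M,N)\, M N)$ operations, it is possible to find $r$ columns $C \in \mathbb{C}^{M \times r}$ of $A$ such that $$\| A - CC^+ A \|_F \leqslant \sqrt{r+1}\, \| A - A_r \|_F .$$
   Context: ''Columns $C\in\mathbb{C}^{M\times r}$ of $A$'' means the $M \times r$ submatrix of $A$ formed by $r$ distinct columns of $A$. $\|\cdot\|_F$ is the Frobenius norm and $C^+$ is the Moore–Penrose pseudoinverse of $C$. If $A = \sum_i \sigma_i u_i v_i^*$ is a singular value decomposition with $\sigma_1 \geqslant \sigma_2 \geqslant \dots$, then $A_r = \sum_{i=1}^r \sigma_i u_i v_i^*$. Operations are elementary exact arithmetic operations (including square roots and comparisons of real numbers), and the singular value decomposition of an $M \times N$ matrix is counted as costing $O(\min(M,N) M N)$ operations. *)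

(* Defs.v *)
From HB Require Import structures.
From mathcomp Require Export all_boot all_order all_algebra.
From mathcomp Require Export boolp classical_sets reals.
From mathcomp Require Export complex.

Set Implicit Arguments.
Unset Strict Implicit.
Unset Printing Implicit Defensive.

Import Order.TTheory GRing.Theory Num.Theory.

Local Open Scope ring_scope.
Local Open Scope sesquilinear_scope.
Local Open Scope complex_scope.

Definition fnorm (R : realType) (m n : nat) (A : 'M[R[i]]_(m, n)) : R :=
  Num.sqrt (\sum_i \sum_j ComplexField.Normc.normc (A i j) ^+ 2).

Definition penrose (K : numClosedFieldType) (m n : nat)
    (A : 'M[K]_(m, n)) (X : 'M[K]_(n, m)) : Prop :=
  [/\ A *m X *m A = A, X *m A *m X = X,
      (A *m X)^t* = A *m X & (X *m A)^t* = X *m A].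

(* MathComp's [pinvmx] is only a partial inverse, not the Moore-Penrose one. *)
Definition mp_pinv (K : numClosedFieldType) (m n : nat) (A : 'M[K]_(m, n)) :
    'M[K]_(n, m) :=
  xget 0 [set X | penrose A X]%classic.

Lemma penrose_uniq (K : numClosedFieldType) (m n : nat) (A : 'M[K]_(m, n))
    (X Y : 'M[K]_(n, m)) : penrose A X -> penrose A Y -> X = Y.
Proof.
move=> [AXA XAX AXh XAh] [AYA YAY AYh YAh].
have ctM p q s (B : 'M[K]_(p, q)) (D : 'M[K]_(q, s)) :
  (B *m D)^t* = D^t* *m B^t* by rewrite trmx_mul map_mxM.
have AXY : A *m X = A *m Y.
  rewrite -{1}AYA -[LHS](mulmxA (A *m Y) A X) -AYh -AXh -ctM.
  by rewrite mulmxA AXA AYh.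
have XAY : X *m A = Y *m A.
  rewrite -{1}AYA -[A *m Y *m A]mulmxA mulmxA -YAh -XAh -ctM.
  by rewrite -[_ *m (X *m A)]mulmxA [A *m (X *m A)]mulmxA AXA YAh.
by rewrite -XAX -mulmxA AXY mulmxA XAY.
Qed.

Lemma gram_unit (K : numClosedFieldType) (k n : nat) (G : 'M[K]_(k, n)) :
  row_free G -> G *m G^t* \in unitmx.
Proof.
move=> Gfree; rewrite -row_free_unit -kermx_eq0 -submx0.
apply/rV_subP => u /sub_kermxP uGG; rewrite submx0.
rewrite -(mulmx_free_eq0 _ Gfree); set w := u *m G.
have ww0 : w *m w^t* = 0.
  by rewrite trmx_mul map_mxM /= mulmxA -(mulmxA u) uGG mul0mx.
have /eqP := congr1 (fun B : 'M_1 => B 0 0) ww0; rewrite !mxE.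
rewrite psumr_eq0 => [/allP w0|j _]; last by rewrite !mxE mul_conjC_ge0.
apply/eqP/rowP => j; apply/eqP.
by have := w0 j (mem_index_enum _); rewrite !mxE mul_conjC_eq0.
Qed.

Lemma penrose_full_rank (K : numClosedFieldType) (m n k : nat)
    (F : 'M[K]_(m, k)) (G : 'M[K]_(k, n)) : row_full F -> row_free G ->
  penrose (F *m G)
    (G^t* *m invmx (G *m G^t*) *m invmx (F^t* *m F) *m F^t*).
Proof.
move=> Ffull Gfree.
have ctM p q s (B : 'M[K]_(p, q)) (D : 'M[K]_(q, s)) :
  (B *m D)^t* = D^t* *m B^t* by rewrite trmx_mul map_mxM.
have Gu : G *m G^t* \in unitmx by rewrite gram_unit.
have Fu : F^t* *m F \in unitmx.
  rewrite -[X in _ *m X]trmxCK gram_unit //.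
  by rewrite /row_free mxrank_map mxrank_tr.
set P := invmx (G *m G^t*); set Q := invmx (F^t* *m F).
have Ph : P^t* = P by rewrite /P trmx_inv map_invmx ctM trmxCK.
have Qh : Q^t* = Q by rewrite /Q trmx_inv map_invmx ctM trmxCK.
have AX : F *m G *m (G^t* *m P *m Q *m F^t*) = F *m Q *m F^t*.
  by rewrite !mulmxA -(mulmxA F G) -(mulmxA F _ P) mulmxV // mulmx1.
have XA : G^t* *m P *m Q *m F^t* *m (F *m G) = G^t* *m P *m G.
  by rewrite !mulmxA -(mulmxA _ (F^t*)) -(mulmxA _ Q) mulVmx // mulmx1.
split.
- by rewrite AX !mulmxA -(mulmxA _ (F^t*)) -(mulmxA _ Q) mulVmx // mulmx1.
- rewrite XA !mulmxA -(mulmxA _ G) -(mulmxA _ (G *m _) P).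
  by rewrite mulmxV // mulmx1.
- by rewrite AX !ctM trmxCK Qh mulmxA.
- by rewrite XA !ctM trmxCK Ph mulmxA.
Qed.

Lemma mp_pinvP (K : numClosedFieldType) (m n : nat) (A : 'M[K]_(m, n)) :
  penrose A (mp_pinv A).
Proof.
rewrite /mp_pinv; case: xgetP => [X _ //|noX]; exfalso.
have := penrose_full_rank (col_base_full A) (row_base_free A).
by rewrite mulmx_base => /noX.
Qed.

(* The thin (economy-size) decomposition, with min(m, n) triples; the k-th
   singular vectors are the k-th columns of [svd_left] and [svd_right]. *)
Record svd_triple (R : realType) (m n : nat) := SVDTriple {
  svd_left : 'M[R[i]]_(m, minn m n);
  svd_vals : 'rV[R]_(minn m n);
  svd_right : 'M[R[i]]_(n, minn m n) }.

Definition is_svd (R : realType) (m n : nat)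
    (A : 'M[R[i]]_(m, n)) (D : svd_triple R m n) : Prop :=
  [/\ A = svd_left D *m diag_mx (map_mx (real_complex R) (svd_vals D))
            *m (svd_right D)^t*,
      (svd_left D)^t* *m svd_left D = 1%:M,
      (svd_right D)^t* *m svd_right D = 1%:M,
      (forall k, 0 <= svd_vals D 0 k) &
      (forall k l : 'I_(minn m n), (k <= l)%N ->
         svd_vals D 0 l <= svd_vals D 0 k)].

Definition truncation (R : realType) (m n r : nat) (D : svd_triple R m n) :
    'M[R[i]]_(m, n) :=
  \sum_(k < minn m n | (k < r)%N)
    (svd_vals D 0 k)%:C *: (col k (svd_left D) *m (col k (svd_right D))^t*).

Definition is_truncated_svd (R : realType) (m n r : nat)
    (A Ar : 'M[R[i]]_(m, n)) : Prop :=
  exists2 D : svd_triple R m n, is_svd A D & Ar = truncation r D.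

(* A program manipulates matrix variables, whose entries are exact complex
   numbers, and integer arrays; both kinds of variables are named by natural
   numbers.  A program is one fixed piece of syntax: it does not depend on the
   dimensions of its input.  Complex numbers can only be combined by the
   operations of [instr] and only influence the control flow, the integers and
   the output through the test [IfRe].  All loops are bounded, so execution is
   total. *)

Inductive iexp :=
| ICst of nat
| IGet of nat & iexp
| IAdd of iexp & iexp
| ISub of iexp & iexp.         (* truncated subtraction *)

Definition IVar (x : nat) : iexp := IGet x (ICst 0).

(* [Loc X i j] is entry (i, j) of matrix variable X. *)
Record loc := Loc { loc_mx : nat; loc_row : iexp; loc_col : iexp }.

Inductive instr :=
| NCst of nat
| NCopy of loc
| NAdd of loc & loc
| NSub of loc & loc
| NMul of loc & loc
| NDiv of loc & loc            (* x / 0 = 0 *)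
| NConj of loc
| NRe of loc
| NIm of loc
| NSqrt of loc.                (* real square root of the real part *)

Inductive cmd :=
| Skip
| Seq of cmd & cmd
| Set_ of loc & instr
| ISet of nat & iexp & iexp    (* [ISet x e e']: x[e] := e' *)
| IfRe of loc & loc & cmd & cmd    (* test Re a <= Re b *)
| IfIdx of iexp & iexp & cmd & cmd (* test e <= e' *)
| For of nat & iexp & cmd      (* [For x e c]: for x[0] = 0, ..., e - 1 do c *)
| CallSVD of nat & iexp & iexp & nat & nat & nat.
    (* [CallSVD X m n U W V]: decompose the leading m x n block of X; store the
       singular vectors in U and V, and the singular values in row 0 of W *)

Record state (R : realType) := State {
  num : nat -> nat -> nat -> R[i];
  idx : nat -> nat -> nat;
  cost : nat;
  nsvd : nat }.

Fixpoint ieval (ix : nat -> nat -> nat) (e : iexp) : nat :=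
  match e with
  | ICst k => k
  | IGet x e1 => ix x (ieval ix e1)
  | IAdd e1 e2 => ieval ix e1 + ieval ix e2
  | ISub e1 e2 => ieval ix e1 - ieval ix e2
  end%N.

Section Semantics.
Variable R : realType.
Implicit Types (st : state R) (l : loc).

Definition fetch st l : R[i] :=
  num st (loc_mx l) (ieval (idx st) (loc_row l)) (ieval (idx st) (loc_col l)).

Definition instr_val st (a : instr) : R[i] :=
  match a with
  | NCst k => k%:R
  | NCopy x => fetch st x
  | NAdd x y => fetch st x + fetch st y
  | NSub x y => fetch st x - fetch st y
  | NMul x y => fetch st x * fetch st y
  | NDiv x y => fetch st x / fetch st y
  | NConj x => (fetch st x)^*
  | NRe x => (complex.Re (fetch st x))%:C
  | NIm x => (complex.Im (fetch st x))%:C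
  | NSqrt x => (Num.sqrt (complex.Re (fetch st x)))%:C
  end.

Definition charge (k : nat) st : state R :=
  State (num st) (idx st) (cost st + k)%N (nsvd st).

Definition set_num (X i j : nat) (z : R[i]) st : state R :=
  State (fun X' i' j' => if [&& X' == X, i' == i & j' == j] then z
                         else num st X' i' j')
        (idx st) (cost st) (nsvd st).

Definition set_idx (x i v : nat) st : state R :=
  State (num st)
        (fun x' i' => if (x' == x) && (i' == i) then v else idx st x' i')
        (cost st) (nsvd st).

Definition read_mx (m n X : nat) st : 'M[R[i]]_(m, n) :=
  \matrix_(i, j) num st X i j.

(* Entries of X outside the m x n block are left unchanged. *)
Definition write_mx (m n X : nat) (B : 'M[R[i]]_(m, n)) st : state R :=
  State (fun X' i j =>
           if X' == X then
             match (insub i : option 'I_m), (insub j : option 'I_n) with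
             | Some i', Some j' => B i' j'
             | _, _ => num st X' i j
             end
           else num st X' i j)
        (idx st) (cost st) (nsvd st).

Definition count_svd st : state R :=
  State (num st) (idx st) (cost st) (nsvd st).+1.

Variable svd : forall m n : nat, 'M[R[i]]_(m, n) -> svd_triple R m n.
Variable csvd : nat.

Definition run_svd (m n X U W V : nat) st : state R :=
  let D := svd (read_mx m n X st) in
  charge (csvd * (minn m n * m * n))%N
    (count_svd
      (write_mx V (svd_right D)
        (write_mx W (map_mx (real_complex R) (svd_vals D))
          (write_mx U (svd_left D) st)))).

(* Every executed assignment and test and every loop iteration costs 1, and an
   m x n decomposition costs csvd * min(m, n) * m * n. *)
Fixpoint exec (c : cmd) st : state R :=
  match c with
  | Skip => st
  | Seq c1 c2 => exec c2 (exec c1 st)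
  | Set_ l a =>
      charge 1 (set_num (loc_mx l) (ieval (idx st) (loc_row l))
                  (ieval (idx st) (loc_col l)) (instr_val st a) st)
  | ISet x e e' => charge 1 (set_idx x (ieval (idx st) e) (ieval (idx st) e') st)
  | IfRe a b c1 c2 =>
      if complex.Re (fetch st a) <= complex.Re (fetch st b)
      then exec c1 (charge 1 st) else exec c2 (charge 1 st)
  | IfIdx e e' c1 c2 =>
      if (ieval (idx st) e <= ieval (idx st) e')%N
      then exec c1 (charge 1 st) else exec c2 (charge 1 st)
  | For x e c1 =>
      iteri (ieval (idx st) e)
        (fun i st' => exec c1 (charge 1 (set_idx x 0 i st'))) (charge 1 st)
  | CallSVD X m n U W V =>
      run_svd (ieval (idx st) m) (ieval (idx st) n) X U W V st
  end.

(* Matrix variable 0 holds A, and integer variables 0, 1, 2 hold M, N, r;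
   everything else is zero. *)
Definition init_state (M N : nat) (A : 'M[R[i]]_(M, N)) (r : nat) : state R :=
  set_idx 2 0 r (set_idx 1 0 N (set_idx 0 0 M
    (write_mx 0 A (State (fun _ _ _ => 0) (fun _ _ => 0%N) 0 0)))).

(* The result is read in entries 0, ..., r - 1 of integer array 3: the numbers
   of the selected columns. *)
Definition returns_columns (N r : nat) st (J : 'I_r -> 'I_N) : Prop :=
  forall t : 'I_r, idx st 3 t = J t.

End Semantics.

(* Main.v *)
Require Import Defs.
From mathcomp Require Import zify.
Import Order.TTheory GRing.Theory Num.Theory.
Local Open Scope ring_scope.

(**
Let V0 be the r x N matrix of the first r right singular vectors (as rows) and
E0 = A - A V0^* V0.  Starting from (V, E) = (V0, E0), one step picks a column
index j and eliminates column j from the stacked matrix [V; E]: with v, e the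
j-th columns of V, E and g = v^* V, replace V by V - v g / |v|^2 and E by
E - e g / |v|^2.  After k steps V V^* is an orthogonal projection of rank r - k
and E V^* = 0, so that |E|_F^2 grows exactly by |e|^2 / |v|^2.  Summing over j
shows that some j satisfies |e|^2 / |v|^2 <= |E|_F^2 / (r - k), and the factors
1 + 1 / (r - k) telescope to r + 1.  After r steps V = 0 and
E = A - (combination of selected columns of A), hence |A - C C^+ A| <= |E|.
Each step costs O(M N), and a Ky Fan inequality shows that the error of the
truncation does not depend on the chosen singular value decomposition.
*)

Set Implicit Arguments.
Unset Strict Implicit.
Unset Printing Implicit Defensive.

(** * Squared Frobenius norms as traces, and Pythagoras for orthogonal projections *)

Section Frobenius.
Local Open Scope sesquilinear_scope.
Variable K : numClosedFieldType.

Lemma adjM m n p (A : 'M[K]_(m, n)) (B : 'M[K]_(n, p)) :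
  (A *m B)^t* = B^t* *m A^t*.
Proof. by rewrite trmx_mul map_mxM. Qed.

Lemma adjB m n (A B : 'M[K]_(m, n)) : (A - B)^t* = A^t* - B^t*.
Proof. by rewrite linearB map_mxB. Qed.

Lemma adjZ m n a (A : 'M[K]_(m, n)) : (a *: A)^t* = a^* *: A^t*.
Proof. by rewrite linearZ map_mxZ. Qed.

Lemma trace_adj n (A : 'M[K]_n) : \tr (A^t*) = (\tr A)^*.
Proof. by rewrite trace_map_mx mxtrace_tr. Qed.

Lemma colM m n p (A : 'M[K]_(m, n)) (B : 'M[K]_(n, p)) l :
  col l (A *m B) = A *m col l B.
Proof. by rewrite !colE mulmxA. Qed.

Definition frob m n (A : 'M[K]_(m, n)) : K := \tr (A *m A^t*).

Lemma frobE m n (A : 'M[K]_(m, n)) :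
  frob A = \sum_i \sum_j A i j * (A i j)^*.
Proof.
by apply: eq_bigr => i _; rewrite mxE; apply: eq_bigr => j _; rewrite !mxE.
Qed.

Lemma frob_ge0 m n (A : 'M[K]_(m, n)) : 0 <= frob A.
Proof.
rewrite frobE !sumr_ge0 // => i _; rewrite sumr_ge0 // => j _.
exact: mul_conjC_ge0.
Qed.

Lemma frob_eq0 m n (A : 'M[K]_(m, n)) : frob A = 0 -> A = 0.
Proof.
rewrite frobE => /eqP; rewrite psumr_eq0 => [/allP Ai0|i _]; last first.
  by rewrite sumr_ge0 // => j _; rewrite mul_conjC_ge0.
apply/matrixP => i j; move: (Ai0 i (mem_index_enum _)) => /=.
rewrite psumr_eq0 => [/allP /(_ j (mem_index_enum _)) /=|l _].
  by rewrite mul_conjC_eq0 mxE => /eqP.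
by rewrite mul_conjC_ge0.
Qed.

Lemma frob_adj m n (A : 'M[K]_(m, n)) : frob (A^t*) = frob A.
Proof. by rewrite /frob trmxCK mxtrace_mulC. Qed.

Lemma frob_col_sum m n (A : 'M[K]_(m, n)) : frob A = \sum_j frob (col j A).
Proof.
rewrite frobE exchange_big; apply: eq_bigr => j _; rewrite frobE.
by apply: eq_bigr => i _; rewrite big_ord1 !mxE.
Qed.

Lemma frobZ m n a (A : 'M[K]_(m, n)) : frob (a *: A) = a * a^* * frob A.
Proof. by rewrite /frob adjZ -scalemxAl -scalemxAr scalerA mxtraceZ. Qed.

Lemma frobN m n (A : 'M[K]_(m, n)) : frob (- A) = frob A.
Proof. by rewrite -scaleN1r frobZ rmorphN rmorph1 mulrNN mulr1 mul1r. Qed.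

Lemma frobB_orth m n (A B : 'M[K]_(m, n)) :
  \tr (A *m B^t*) = 0 -> frob (A - B) = frob A + frob B.
Proof.
move=> AB; have BA : \tr (B *m A^t*) = 0.
  by rewrite -[B]trmxCK -adjM trace_adj AB conjC0.
rewrite /frob adjB mulmxBr !mulmxBl !raddfB /= BA AB.
by rewrite subr0 oppr0 sub0r opprK.
Qed.

(** Pythagoras: the cross term contains [Q (1 - Q) = 0], because [Q] is self-adjoint. *)
Lemma frob_proj_split m n (Q : 'M[K]_m) (Z : 'M[K]_(m, n)) :
  Q *m Q = Q -> Q^t* = Q -> frob Z = frob (Z - Q *m Z) + frob (Q *m Z).
Proof.
move=> QQ Qh; pose Y := Z - Q *m Z.
(* [frobB_orth] concerns differences, so [Z] is written as [Y - (- (Q *m Z))]. *)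
have YQ : \tr (Y *m (- (Q *m Z))^t*) = 0.
  rewrite -scaleN1r adjZ -scalemxAr mxtraceZ adjM Qh mulmxA mxtrace_mulC.
  by rewrite mulmxA /Y mulmxBr mulmxA QQ subrr mul0mx linear0 mulr0.
have := frobB_orth YQ; rewrite opprK subrK => ->.
by rewrite frobN.
Qed.

Lemma frob_projC_le m n (Q : 'M[K]_m) (Z : 'M[K]_(m, n)) :
  Q *m Q = Q -> Q^t* = Q -> frob (Z - Q *m Z) <= frob Z.
Proof. by move=> QQ Qh; rewrite (frob_proj_split Z QQ Qh) lerDl frob_ge0. Qed.

Lemma frob_outer m n (u : 'cV[K]_m) (w : 'rV[K]_n) :
  frob (u *m w) = frob u * frob w.
Proof.
rewrite /frob adjM mulmxA mxtrace_mulC !mulmxA -(mulmxA (u^t* *m u)).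
rewrite [u^t* *m u]mx11_scalar mul_scalar_mx mxtraceZ; congr (_ * _).
by rewrite [RHS]mxtrace_mulC trace_mx11.
Qed.

(** * One elimination step, for a partial isometry [V] and a matrix [E] with rows orthogonal to
    those of [V] *)

Section Step.
Variables (r M N : nat) (V : 'M[K]_(r, N)) (E : 'M[K]_(M, N)) (j : 'I_N).
Hypotheses (VVV : V *m V^t* *m V = V) (EV : E *m V^t* = 0).
Hypothesis pj_gt0 : 0 < frob (col j V).

Definition pivot_row : 'rV[K]_N := (col j V)^t* *m V.
(** This is right multiplication by [1 - e_j g / p], with the same factor for [V] and [E]. As
    [g e_j = p], the factor is an oblique projection. *)
Definition deflate m (B : 'M[K]_(m, N)) : 'M[K]_(m, N) :=
  B - (frob (col j V))^-1 *: (col j B *m pivot_row).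

Let v := col j V.
Let p := frob v.
Let g := pivot_row.

Let p0 : p != 0. Proof. exact: lt0r_neq0. Qed.

Let vv : v^t* *m v = p%:M.
Proof. by rewrite [LHS]mx11_scalar -trace_mx11 mxtrace_mulC. Qed.
Let VVv : V *m (V^t* *m v) = v.
Proof. by rewrite mulmxA /v colE mulmxA VVV. Qed.
Let gE : g = v^t* *m V. Proof. by []. Qed.
Let gadj : g^t* = V^t* *m v. Proof. by rewrite gE adjM trmxCK. Qed.
Let gg : g *m g^t* = p%:M.
Proof. by rewrite gadj gE -mulmxA VVv vv. Qed.

(** Since [V g^* = v] and [g g^* = p], on [V] itself the step is the orthogonal projection of the
    rows off the direction [g]. *)
Lemma deflate_pivot : deflate V *m g^t* = 0.
Proof.
rewrite mulmxBl gadj VVv -scalemxAl -mulmxA -/g -gadj gg mul_mx_scalar scalerA.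
by rewrite mulVf // scale1r subrr.
Qed.

Lemma deflate_col m (B : 'M[K]_(m, N)) : col j (deflate B) = 0.
Proof.
rewrite linearB linearZ /= !colM -/v vv mul_mx_scalar scalerA mulVf //.
by rewrite scale1r subrr.
Qed.

(** Eliminated columns of [V] stay zero, so no column can serve as pivot twice. *)
Lemma deflate_col0 l : col l V = 0 -> col l (deflate V) = 0.
Proof.
by move=> Vl; rewrite linearB linearZ /= !colM Vl !mulmx0 scaler0 subrr.
Qed.

Let deflateVV : deflate V *m (deflate V)^t* = deflate V *m V^t*.
Proof.
rewrite [X in _ *m X]adjB adjZ adjM -/g mulmxBr -scalemxAr mulmxA deflate_pivot.
by rewrite mul0mx scaler0 subr0.
Qed.

Lemma deflate_isometry :
  deflate V *m (deflate V)^t* *m deflate V = deflate V.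
Proof.
(* With [B] equal to [deflate V], this replaces the last factor [deflate V] by [V]. *)
have VgV m (B : 'M[K]_(m, N)) : B *m (V^t* *m v) = 0 ->
  B *m V^t* *m deflate V = B *m V^t* *m V.
  move=> B0; rewrite mulmxBr -scalemxAr [_ *m (_ *m pivot_row)]mulmxA.
  by rewrite -(mulmxA B) B0 mul0mx scaler0 subr0.
rewrite deflateVV VgV; last by rewrite -gadj deflate_pivot.
rewrite 2!mulmxBl -2!scalemxAl VVV; congr (_ - _ *: _).
by rewrite -!mulmxA [V *m (_ *m V)]mulmxA VVV.
Qed.

(** The deflated [V] annihilates [g^*], and [E g^* = E V^* v = 0]. *)
Lemma deflate_orth : deflate E *m (deflate V)^t* = 0.
Proof.
rewrite mulmxBl -scalemxAl -mulmxA.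
rewrite -[pivot_row]trmxCK -adjM deflate_pivot trmx0 map_mx0 mulmx0 scaler0.
rewrite subr0.
rewrite adjB adjZ adjM -/g mulmxBr EV -scalemxAr mulmxA gadj mulmxA EV.
by rewrite !mul0mx scaler0 subrr.
Qed.

(** For a partial isometry [frob] is the rank; the step removes one dimension. *)
Lemma deflate_trace : frob (deflate V) = frob V - 1.
Proof.
rewrite /frob deflateVV mulmxBl linearB /= -scalemxAl linearZ /= -/v.
rewrite -mulmxA -/g -{1}(trmxCK g) -adjM gadj VVv -/(frob v) -/p.
by rewrite mulVf.
Qed.

(** The rows of [E] are orthogonal to [g], so Pythagoras adds [|e|^2 |g|^2 / p^2], where
    [|g|^2 = p]. *)
Lemma deflate_frob : frob (deflate E) = frob E + frob (col j E) / p.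
Proof.
rewrite frobB_orth; last first.
  by rewrite adjZ adjM -/g gadj -scalemxAr !mulmxA EV !mul0mx scaler0 linear0.
have fg : frob g = p by rewrite /frob gg mxtrace_scalar.
rewrite frobZ frob_outer -/v -/p -/g fg geC0_conj ?invr_ge0 ?(ltW pj_gt0) //.
by congr (_ + _); rewrite mulrACA mulVf // mulr1 mulrC.
Qed.

End Step.

(** Averaging: if the inequality failed wherever [p j > 0], summing over all indices would give a
    strict inequality between equal numbers. The cross-multiplied form is the one the program
    tests. *)
Lemma select_exists (I : finType) (p e : I -> K) :
  (forall j, 0 <= p j) -> (forall j, 0 <= e j) -> 0 < \sum_j p j ->
  exists2 j, 0 < p j & (\sum_i p i) * e j <= (\sum_i e i) * p j.
Proof.
move=> p0 e0 t0; set t := \sum_i p i; set T := \sum_i e i.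
have T0 : 0 <= T by rewrite sumr_ge0.
apply: contrapT => no.
have lt0 j : 0 < p j -> T * p j < t * e j.
  (* The order of [K] is partial, so negating the comparison requires both sides to be real. *)
  move=> pj; rewrite real_ltNge ?realM ?ger0_real // ?(ltW t0) //.
  by apply/negP => le; apply: no; exists j.
have le0 j : T * p j <= t * e j.
  have [->|pj] := eqVneq (p j) 0; first by rewrite mulr0 mulr_ge0 // ltW.
  by rewrite ltW // lt0 // lt_def pj p0.
have [j pj] : exists j, 0 < p j.
  apply: contrapT => all0; move: t0; rewrite big1 ?ltxx // => j _.
  by apply: contrapT => /eqP pj; apply: all0; exists j; rewrite lt_def pj p0.
suff : \sum_i T * p i < \sum_i t * e i.
  by rewrite -!mulr_sumr -/t -/T mulrC ltxx.
rewrite (bigD1 j) //= [X in _ < X](bigD1 j) //= ltr_leD ?lt0 //.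
by apply: ler_sum.
Qed.

End Frobenius.

(** * Optimality of the leading singular vectors *)

Section KyFan.
Local Open Scope sesquilinear_scope.
Variable K : numClosedFieldType.

Lemma frob_isometry m n p (U : 'M[K]_(m, n)) (Z : 'M[K]_(n, p)) :
  U^t* *m U = 1%:M -> frob (U *m Z) = frob Z.
Proof.
move=> UU; rewrite /frob adjM mxtrace_mulC -mulmxA [U^t* *m _]mulmxA UU mul1mx.
by rewrite mxtrace_mulC.
Qed.

Lemma frob_proj m n p (W : 'M[K]_(n, p)) (Z : 'M[K]_(n, m)) :
  W^t* *m W = 1%:M ->
  frob (Z - W *m W^t* *m Z) = frob Z - frob (W^t* *m Z).
Proof.
move=> WW; have QQ : W *m W^t* *m (W *m W^t*) = W *m W^t*.
  by rewrite mulmxA -(mulmxA W) WW mulmx1.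
have Qh : (W *m W^t*)^t* = W *m W^t* by rewrite adjM trmxCK.
rewrite (frob_proj_split Z QQ Qh) -[W *m _ *m Z]mulmxA (frob_isometry _ WW).
by rewrite addrK.
Qed.

Lemma bessel m n p (W : 'M[K]_(n, p)) (Z : 'M[K]_(n, m)) :
  W^t* *m W = 1%:M -> frob (W^t* *m Z) <= frob Z.
Proof. by move=> WW; rewrite -subr_ge0 -frob_proj // frob_ge0. Qed.

Lemma frob_diag_mul p n (s : 'rV[K]_p) (Z : 'M[K]_(p, n)) :
  frob (diag_mx s *m Z) = \sum_l s 0 l * (s 0 l)^* * frob (row l Z).
Proof.
rewrite frobE; apply: eq_bigr => l _; rewrite frobE big_ord1 mulr_sumr.
by apply: eq_bigr => k _; rewrite mul_diag_mx !mxE rmorphM mulrACA.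
Qed.

Lemma frob_row_sum m n (A : 'M[K]_(m, n)) : frob A = \sum_i frob (row i A).
Proof.
rewrite frobE; apply: eq_bigr => i _; rewrite frobE big_ord1.
by apply: eq_bigr => j _; rewrite !mxE.
Qed.

(** The scalar core of the Ky Fan inequality: a total weight of at most [r], capped at 1 per index,
    is best spent on the [r] largest coefficients. *)
Lemma weighted_sum_le p r (c w : 'I_p -> K) : (r <= p)%N ->
  (forall k, 0 <= c k) -> (forall k l : 'I_p, (k <= l)%N -> c l <= c k) ->
  (forall k, 0 <= w k <= 1) -> \sum_k w k <= r%:R ->
  \sum_k c k * w k <= \sum_(k < p | (k < r)%N) c k.
Proof.
move=> rp c0 cmono w01 sw.
(* For [r = 0] there is no threshold index [r.-1], but then all weights vanish. *)
have [r0|r0] := posnP r.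
  rewrite [X in _ <= X]big_pred0 => [|k]; last by rewrite r0.
  have w0 k : w k = 0.
    apply/eqP; rewrite eq_le (andP (w01 k)).1 andbT.
    rewrite (le_trans _ (le_trans sw _)) ?r0 //.
    by rewrite (bigD1 k) //= lerDl sumr_ge0 // => l _; rewrite (andP (w01 l)).1.
  by rewrite big1 // => k _; rewrite w0 mulr0.
have pr : (r.-1 < p)%N by rewrite prednK.
(* Replacing each [c k] by the threshold value [d] only decreases
   [right-hand side - left-hand side]. *)
pose d := c (Ordinal pr).
rewrite -subr_ge0 big_mkcond /= -sumrB.
have dw : 0 <= d * (r%:R - \sum_k w k) by rewrite mulr_ge0 ?subr_ge0 ?c0.
rewrite (le_trans dw) //.
have -> : r%:R = \sum_(k < p) (k < r)%:R :> K.
  rewrite -natr_sum -(big_mkcond (fun k : 'I_p => (k < r)%N) (fun=> 1%N)) /=.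
  by rewrite -(big_ord_widen p (fun=> 1%N) rp) sum1_card card_ord.
(* Termwise, [(c k - d) * ((k < r) - w k)] is nonnegative: both factors are nonnegative for [k < r]
   and nonpositive afterwards. *)
rewrite -sumrB mulr_sumr; apply: ler_sum => k _.
have [w0 w1] := andP (w01 k).
case: ltnP => kr.
  rewrite -{1}[c k]mulr1 -mulrBr ler_wpM2r ?subr_ge0 //.
  by apply: cmono; rewrite /= -ltnS prednK.
rewrite !sub0r mulrN lerN2 ler_wpM2r //.
by apply: cmono; rewrite /= (leq_trans (leq_pred r)).
Qed.

(* The right-hand side is the sum of the [r] largest squared singular values. *)
Lemma ky_fan M N p r (U : 'M[K]_(M, p)) (s : 'rV[K]_p) (V : 'M[K]_(N, p))
    (rp : (r <= p)%N) (W : 'M[K]_(N, r)) :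
  U^t* *m U = 1%:M -> V^t* *m V = 1%:M -> (forall k, 0 <= s 0 k) ->
  (forall k l : 'I_p, (k <= l)%N -> s 0 l <= s 0 k) -> W^t* *m W = 1%:M ->
  frob (U *m diag_mx s *m V^t* *m W)
    <= frob (U *m diag_mx s *m V^t* *m colsub (widen_ord rp) V).
Proof.
move=> UU VV s0 smono WW.
have frobU (Z : 'M[K]_(N, r)) : frob (U *m diag_mx s *m V^t* *m Z) =
    \sum_l s 0 l * (s 0 l)^* * frob (row l (V^t* *m Z)).
  by rewrite -!mulmxA (frob_isometry _ UU) frob_diag_mul.
rewrite !frobU.
(* Row [l] of [V^*] times the leading columns is a unit vector if [l < r] and zero otherwise. *)
have -> : \sum_l s 0 l * (s 0 l)^* *
     frob (row l (V^t* *m colsub (widen_ord rp) V)) =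
   \sum_(l < p | (l < r)%N) s 0 l * (s 0 l)^*.
  rewrite [RHS]big_mkcond; apply: eq_bigr => l _ /=.
  rewrite mulmx_colsub VV frobE big_ord1; under eq_bigr do rewrite !mxE.
  case: ltnP => lr.
    rewrite (bigD1 (Ordinal lr)) //= big1 => [|k kl]; last first.
      by rewrite -val_eqE /= eq_sym [_ == _](negbTE kl) mul0r.
    by rewrite -val_eqE /= eqxx conjC1 addr0 !mulr1.
  rewrite big1 ?mulr0 // => k _.
  by rewrite -val_eqE /= gtn_eqF ?mul0r // (leq_trans _ lr).
(* The weights are the squared row norms of [V^* W]. Bessel for [W] bounds each by 1, and Bessel for
   [V] bounds their sum by [frob W = r]. *)
apply: weighted_sum_le => //.
- by move=> k; rewrite mul_conjC_ge0.
- by move=> k l kl; rewrite !geC0_conj // ler_pM ?smono.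
- move=> l; rewrite frob_ge0 /= row_mul.
  rewrite -frob_adj adjM (le_trans (bessel _ WW)) //.
  rewrite frob_adj.
  have : (V^t* *m V) l l = 1 by rewrite VV mxE eqxx.
  rewrite mxE frobE big_ord1 => <-; apply: ler_sum => k _.
  by rewrite !mxE conjCK.
rewrite -frob_row_sum (le_trans (bessel _ VV)) //.
by rewrite -frob_adj /frob trmxCK WW mxtrace1.
Qed.

End KyFan.

(** * The invariant of the greedy elimination and the resulting error bound *)

Section Greedy.
Local Open Scope sesquilinear_scope.
Variable K : numClosedFieldType.

(** [greedy_error] is the telescoped product of the growth factors. In [greedy_elim] all steps are
    gathered in one factor [1 - Y], where only selected rows of [Y] are nonzero. [J] is a function
    on [nat], like the output array of the program. *)
Record greedy r M N (V0 : 'M[K]_(r, N)) (E0 : 'M[K]_(M, N)) (k : nat)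
    (J : nat -> nat) (V : 'M[K]_(r, N)) (E : 'M[K]_(M, N)) : Prop := Greedy {
  greedy_isometry : V *m V^t* *m V = V;
  greedy_orth : E *m V^t* = 0;
  greedy_trace : frob V = (r - k)%:R;
  greedy_error : frob E * (r - k).+1%:R <= frob E0 * r.+1%:R;
  greedy_elim : exists Y : 'M_N,
    [/\ V = V0 - V0 *m Y, E = E0 - E0 *m Y &
        forall l b, Y l b != 0 -> exists2 t, (t < k)%N & J t = l];
  greedy_zero : forall t (l : 'I_N), (t < k)%N -> J t = l -> col l V = 0;
  greedy_range : forall t, (t < k)%N -> (J t < N)%N;
  greedy_inj : forall t u, (t < k)%N -> (u < k)%N -> J t = J u -> t = u }.

Lemma greedy_init r M N (V0 : 'M[K]_(r, N)) (E0 : 'M[K]_(M, N)) J :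
  V0 *m V0^t* = 1%:M -> E0 *m V0^t* = 0 -> greedy V0 E0 0 J V0 E0.
Proof.
move=> VV EV; split => //; rewrite ?subn0 //.
- by rewrite VV mul1mx.
- by rewrite /frob VV mxtrace1.
- by exists 0; rewrite !mulmx0 !subr0; split => // l b; rewrite mxE eqxx.
Qed.

Lemma greedy_step r M N (V0 : 'M[K]_(r, N)) (E0 : 'M[K]_(M, N)) k J J' V E
    (j : 'I_N) :
  greedy V0 E0 k J V E -> (k < r)%N -> 0 < frob (col j V) ->
  frob V * frob (col j E) <= frob E * frob (col j V) ->
  (forall t, (t < k)%N -> J' t = J t) -> J' k = j ->
  greedy V0 E0 k.+1 J' (deflate V j V) (deflate V j E).
Proof.
move=> [VVV EV trV err [Y [VY EY Ysupp]] Vz Jr Jinj] kr p0 sel J'J J'k.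
(* Columns of [V] selected earlier are zero, whereas the pivot column is not. *)
have Jfresh t : (t < k)%N -> J t <> j.
  by move=> tk Jt; move: p0; rewrite (Vz _ _ tk Jt) /frob mul0mx linear0 ltxx.
(* The new multiplier comes from expanding [(1 - Y) (1 - e_j g / p)]. *)
have defl m (B B0 : 'M[K]_(m, N)) : B = B0 - B0 *m Y -> deflate V j B =
    B0 - B0 *m (Y + (frob (col j V))^-1 *: (col j (1%:M - Y) *m pivot_row V j)).
  move=> BE; rewrite /deflate mulmxDr -scalemxAr (mulmxA B0) -colM mulmxBr.
  by rewrite mulmx1 -BE opprD addrA -BE.
split.
- exact: deflate_isometry.
- exact: deflate_orth.
- rewrite deflate_trace // trV subnS -[in LHS](@prednK (r - k)) ?subn_gt0 //.
  by rewrite -natr1 addrK.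
(* With [frob V = r - k], the selection rule says that [r - k] times the growth of [frob E] is at
   most [frob E]. *)
- rewrite deflate_frob // (le_trans _ err) //.
  rewrite subnS prednK ?subn_gt0 // -[in X in _ <= X]addn1 natrD mulrDr mulr1.
  rewrite mulrDl lerD2l -trV mulrAC ler_pdivrMr //.
  by rewrite mulrC.
- exists (Y + (frob (col j V))^-1 *: (col j (1%:M - Y) *m pivot_row V j)).
  split; [exact: defl | exact: defl |] => l b; rewrite !mxE big_ord1 !mxE.
  (* A nonzero entry in row [l] of the new multiplier forces [Y l b] or [Y l j] to be nonzero, or
     [l = j]. *)
  have [Ylb|Ylb _] := eqVneq (Y l b) 0; last first.
    have [t tk Jt] := Ysupp _ _ Ylb; exists t; rewrite ?J'J //; exact: ltnW.
  have [Ylj|Ylj _] := eqVneq (Y l j) 0; last first.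
    have [t tk Jt] := Ysupp _ _ Ylj; exists t; rewrite ?J'J //; exact: ltnW.
  rewrite Ylb Ylj; have [->|_] := eqVneq l j; first by exists k.
  by rewrite subrr mul0r mulr0 addr0 eqxx.
- move=> t l; rewrite ltnS leq_eqVlt => /predU1P[->|tk].
    by rewrite J'k => /val_inj <-; rewrite deflate_col.
  by rewrite J'J // => Jt; rewrite deflate_col0 // (Vz _ _ tk Jt).
- move=> t; rewrite ltnS leq_eqVlt => /predU1P[->|tk]; first by rewrite J'k.
  by rewrite J'J // Jr.
- move=> t u; rewrite ltnS leq_eqVlt => /predU1P[->|tk];
    rewrite ltnS leq_eqVlt => /predU1P[->|uk] //.
  + by rewrite J'k J'J // => /esym /Jfresh.
  + by rewrite J'k J'J // => /Jfresh.
  + by rewrite !J'J //; apply: Jinj.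
Qed.

Lemma greedy_select r M N (V0 : 'M[K]_(r, N)) (E0 : 'M[K]_(M, N)) k J V E :
  greedy V0 E0 k J V E -> (k < r)%N ->
  exists2 j, 0 < frob (col j V) &
    frob V * frob (col j E) <= frob E * frob (col j V).
Proof.
case=> _ _ trV _ _ _ _ _ kr.
rewrite !(frob_col_sum V) !(frob_col_sum E); apply: select_exists.
- by move=> j; apply: frob_ge0.
- by move=> j; apply: frob_ge0.
- by rewrite -frob_col_sum trV ltr0n subn_gt0.
Qed.

(** Modulo the span of the selected columns [A] equals the final [E], and the projection away from
    that span does not increase the norm. *)
Lemma greedy_final r M N (A : 'M[K]_(M, N)) (V0 : 'M[K]_(r, N)) J V E
    (f : 'I_r -> 'I_N) :
  greedy V0 (A - A *m V0^t* *m V0) r J V E -> (forall t : 'I_r, J t = f t) ->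
  frob (A - colsub f A *m mp_pinv (colsub f A) *m A)
    <= frob (A - A *m V0^t* *m V0) * r.+1%:R.
Proof.
case=> _ _ trV err [Y [VY EY Ysupp]] _ _ _ Jf.
set E0 := A - _ in EY err *; set C := colsub f A; set Q := C *m mp_pinv C.
have V0Y : V0 = V0 *m Y.
  by apply/eqP; rewrite -subr_eq0 -VY (@frob_eq0 _ _ _ V) ?trV ?subnn.
(* As [V = V0 (1 - Y)] has vanished, so has the contribution of [A V0^* V0]. *)
have EA : E = A - A *m Y.
  rewrite EY /E0 mulmxBl -!(mulmxA (A *m _)) -V0Y.
  by rewrite opprB addrA subrK.
have [CXC XCX Ch _] := mp_pinvP C.
have QQ : Q *m Q = Q by rewrite /Q mulmxA CXC.
(* The columns of [A *m Y] are combinations of selected columns, which [Q] fixes. *)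
have QAY : Q *m (A *m Y) = A *m Y.
  rewrite mulmxA; apply/matrixP => a b; rewrite !mxE; apply: eq_bigr => l _.
  have [->|Ylb] := eqVneq (Y l b) 0; first by rewrite !mulr0.
  have [t tr Jt] := Ysupp _ _ Ylb; congr (_ * _).
  have lE : l = f (Ordinal tr) by apply: val_inj; rewrite /= -Jf -Jt.
  have : (Q *m C) a (Ordinal tr) = C a (Ordinal tr) by rewrite /Q CXC.
  by rewrite [in X in X -> _]mulmx_colsub !mxE -lE.
have -> : A - Q *m A = E - Q *m E.
  by rewrite EA mulmxBr QAY opprB addrA subrK.
apply: (le_trans (frob_projC_le _ QQ Ch)).
by move: err; rewrite subnn mulr1.
Qed.

End Greedy.

(** * Truncated singular value decompositions and the norm [fnorm] *)

Section Truncation.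
Local Open Scope sesquilinear_scope.
Local Open Scope complex_scope.
Variable R : realType.

Lemma colsub_ortho (K : numClosedFieldType) n p r (V : 'M[K]_(n, p))
    (rp : (r <= p)%N) :
  V^t* *m V = 1%:M ->
  (colsub (widen_ord rp) V)^t* *m colsub (widen_ord rp) V = 1%:M.
Proof.
move=> VV; apply/matrixP => i j.
have := congr1 (fun B : 'M_p => B (widen_ord rp i) (widen_ord rp j)) VV.
rewrite !mxE -val_eqE /= val_eqE => <-.
by apply: eq_bigr => k _; rewrite !mxE.
Qed.

Definition leading m n r (D : svd_triple R m n) (rp : (r <= minn m n)%N) :=
  colsub (widen_ord rp) (svd_right D).

(** Orthonormality of the right vectors reduces [A *m leading D rp] to scaled left vectors. The
    starting matrix [E0] is thus the truncation error. *)
Lemma truncation_proj m n r (A : 'M[R[i]]_(m, n)) (D : svd_triple R m n)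
    (rp : (r <= minn m n)%N) : is_svd A D ->
  truncation r D = A *m leading D rp *m (leading D rp)^t*.
Proof.
case=> AE UU VV _ _; rewrite /leading; set Vr := colsub _ _.
set S := diag_mx _ in AE.
have -> : A *m Vr = svd_left D *m colsub (widen_ord rp) S.
  by rewrite AE -!mulmxA mulmx_colsub VV !mulmx_colsub mulmx1.
apply/matrixP => i j; rewrite /truncation (big_ord_narrow rp) summxE.
rewrite mulmx_colsub mul_mx_diag !mxE.
apply: eq_bigr => k _; rewrite !mxE big_ord1 !mxE.
by rewrite mulrA; congr (_ * _); rewrite mulrC.
Qed.

(** The squared error is [frob A - frob (A *m leading D rp)], and Ky Fan says that the leading
    vectors of [D] maximise the subtracted term. With repeated singular values the truncations
    themselves may differ, so this links the given one to that of the program. *)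
Lemma truncation_error_le m n r (A : 'M[R[i]]_(m, n))
    (D D' : svd_triple R m n) :
  (r <= minn m n)%N -> is_svd A D -> is_svd A D' ->
  frob (A - truncation r D) <= frob (A - truncation r D').
Proof.
move=> rp Dsvd D'svd.
have err D1 : is_svd A D1 ->
    frob (A - truncation r D1) = frob A - frob (A *m leading D1 rp).
  move=> D1svd; have [_ _ VV _ _] := D1svd.
  rewrite (truncation_proj rp D1svd) -frob_adj adjB !adjM trmxCK mulmxA.
  rewrite frob_proj; last exact: colsub_ortho.
  by rewrite -adjM !frob_adj.
rewrite (err _ Dsvd) (err _ D'svd) lerD2l lerN2.
have [_ _ VV' _ _] := D'svd; have [AE UU VV s0 smono] := Dsvd.
rewrite {1 2}AE; apply: ky_fan => //.
- by move=> k; rewrite mxE ler0c.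
- by move=> k l kl; rewrite !mxE lecR smono.
- exact: colsub_ortho.
Qed.

Lemma fnorm_frob m n (A : 'M[R[i]]_(m, n)) : (fnorm A ^+ 2)%:C = frob A.
Proof.
rewrite /fnorm sqr_sqrtr; last first.
  by rewrite !sumr_ge0 // => i _; rewrite sumr_ge0 // => j _; rewrite sqr_ge0.
rewrite frobE rmorph_sum; apply: eq_bigr => i _; rewrite rmorph_sum.
by apply: eq_bigr => j _; rewrite -normCK rmorphXn.
Qed.

Lemma fnorm_le m n p q c (A : 'M[R[i]]_(m, n)) (B : 'M[R[i]]_(p, q)) :
  frob A <= frob B * c%:R -> fnorm A <= Num.sqrt c%:R * fnorm B.
Proof.
have fn0 a b (X : 'M[R[i]]_(a, b)) : 0 <= fnorm X by rewrite sqrtr_ge0.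
rewrite -!fnorm_frob -(rmorph_nat (real_complex R)) -rmorphM lecR => le.
rewrite -(@ler_pXn2r _ 2) ?nnegrE ?mulr_ge0 ?sqrtr_ge0 //.
by rewrite exprMn (@sqr_sqrtr _ c%:R) ?ler0n // mulrC.
Qed.

End Truncation.

(** * Reasoning about programs: assigned variables, loop rules and cost bounds *)

Fixpoint wnum (c : cmd) : seq nat :=
  match c with
  | Seq c1 c2 | IfRe _ _ c1 c2 | IfIdx _ _ c1 c2 => wnum c1 ++ wnum c2
  | Set_ l _ => [:: loc_mx l]
  | For _ _ c1 => wnum c1
  | CallSVD _ _ _ U W V => [:: U; W; V]
  | _ => [::]
  end.

Fixpoint widx (c : cmd) : seq nat :=
  match c with
  | Seq c1 c2 | IfRe _ _ c1 c2 | IfIdx _ _ c1 c2 => widx c1 ++ widx c2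
  | ISet x _ _ => [:: x]
  | For x _ c1 => x :: widx c1
  | _ => [::]
  end.

Fixpoint ivars (e : iexp) : seq nat :=
  match e with
  | ICst _ => [::]
  | IGet x e1 => x :: ivars e1
  | IAdd e1 e2 | ISub e1 e2 => ivars e1 ++ ivars e2
  end.

(* No loop bound reads an array in [W], while all assigned ones are in [W]. *)
Fixpoint fixed_bounds (W : seq nat) (c : cmd) : bool :=
  match c with
  | Seq c1 c2 | IfRe _ _ c1 c2 | IfIdx _ _ c1 c2 =>
      fixed_bounds W c1 && fixed_bounds W c2
  | ISet x _ _ => x \in W
  | For x e c1 => [&& x \in W, all [predC W] (ivars e) & fixed_bounds W c1]
  | CallSVD _ _ _ _ _ _ => false
  | _ => true
  end.

(** Both branches of a test are charged, and loop bounds are evaluated once and for all in [ix]. The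
    value 0 at [CallSVD] is harmless, as [fixed_bounds] rejects that command. *)
Fixpoint static_cost (ix : nat -> nat -> nat) (c : cmd) : nat :=
  match c with
  | Seq c1 c2 => static_cost ix c1 + static_cost ix c2
  | IfRe _ _ c1 c2 | IfIdx _ _ c1 c2 =>
      1 + (static_cost ix c1 + static_cost ix c2)
  | Set_ _ _ | ISet _ _ _ => 1
  | For _ e c1 => 1 + ieval ix e * (1 + static_cost ix c1)
  | _ => 0
  end.

Section Programs.
Local Open Scope sesquilinear_scope.
Local Open Scope complex_scope.
Variables (R : realType)
  (svd : forall m n : nat, 'M[R[i]]_(m, n) -> svd_triple R m n) (csvd : nat).
Implicit Types (s : state R).
Local Notation run := (exec svd csvd).

Definition frame (c : cmd) s s' : Prop :=
  (forall X : nat, X \notin wnum c -> num s' X = num s X) /\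
  (forall x : nat, x \notin widx c -> idx s' x = idx s x).

Lemma frame_trans c s1 s2 s3 : frame c s1 s2 -> frame c s2 s3 -> frame c s1 s3.
Proof.
move=> [n12 i12] [n23 i23]; split=> X Xc; first by rewrite n23 // n12.
by rewrite i23 // i12.
Qed.

Lemma frame_sub c c' s s' : {subset wnum c <= wnum c'} ->
  {subset widx c <= widx c'} -> frame c s s' -> frame c' s s'.
Proof.
move=> sn si [fn fi]; split=> X Xc.
  by rewrite fn //; apply: contra Xc => /sn.
by rewrite fi //; apply: contra Xc => /si.
Qed.

Lemma frame_set_idx c x i v s : x \in widx c -> frame c s (set_idx x i v s).
Proof.
move=> xc; split=> // y yc; apply/funext => j /=.
by case: eqP yc xc => //= -> /negP.
Qed.

Lemma frame_for_set_idx x e c i s :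
  frame (For x e c) s (charge 1 (set_idx x 0 i s)).
Proof. by apply: (@frame_set_idx (For x e c) x 0 i s); rewrite /= inE eqxx. Qed.

Lemma exec_frame c s : frame c s (run c s).
Proof.
elim: c s => //.
- move=> c1 IH1 c2 IH2 s; apply: (@frame_trans _ _ (run c1 s)).
    by apply: frame_sub (IH1 s) => y /= yc; rewrite mem_cat yc.
  by apply: frame_sub (IH2 _) => y /= yc; rewrite mem_cat yc orbT.
- move=> l a s; split=> //= X; rewrite inE => /negbTE Xl.
  by apply/funext => i; apply/funext => j; rewrite Xl.
- by move=> x e e' s; apply: (@frame_set_idx (ISet x e e')); rewrite inE.
- move=> a b c1 IH1 c2 IH2 s /=; case: ifP => _.
    by apply: frame_sub (IH1 _) => y /= yc; rewrite mem_cat yc.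
  by apply: frame_sub (IH2 _) => y /= yc; rewrite mem_cat yc orbT.
- move=> a b c1 IH1 c2 IH2 s /=; case: ifP => _.
    by apply: frame_sub (IH1 _) => y /= yc; rewrite mem_cat yc.
  by apply: frame_sub (IH2 _) => y /= yc; rewrite mem_cat yc orbT.
- move=> x e c IH s /=; elim: (ieval _ _) => //= n IHn.
  apply: (frame_trans IHn); apply: frame_trans (frame_for_set_idx _ _ _ n _) _.
  by apply: frame_sub (IH _) => // y yc /=; rewrite inE yc orbT.
- move=> X m n U W V s; split=> // Y /=; rewrite !inE !negb_or.
  by case/and3P=> /negbTE YU /negbTE YW /negbTE YV; rewrite YU YW YV.
Qed.

(** The frame is handed to the body, so an invariant need not mention variables that the loop never
    assigns. *)
Lemma exec_for x e c s0 (Inv : nat -> state R -> Prop) :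
  Inv 0%N (charge 1 s0) ->
  (forall i s, (i < ieval (idx s0) e)%N -> frame (For x e c) s0 s -> Inv i s ->
     Inv i.+1 (run c (charge 1 (set_idx x 0 i s)))) ->
  Inv (ieval (idx s0) e) (run (For x e c) s0).
Proof.
move=> Inv0 IS /=; set n := ieval _ _ in IS *.
suff : forall k, (k <= n)%N -> let s := iteri k (fun i st' =>
    run c (charge 1 (set_idx x 0 i st'))) (charge 1 s0) in
    Inv k s /\ frame (For x e c) s0 s.
  by case/(_ n (leqnn n)).
elim=> [|k IH] kn; first by split.
have [Ik Fk] := IH (ltnW kn); split; first exact: IS.
apply: (frame_trans Fk); apply: frame_trans (frame_for_set_idx _ _ _ k _) _.
by apply: frame_sub (exec_frame c _) => // y yc /=; rewrite inE yc orbT.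
Qed.

(** Rule for a double loop that fills a block of [X] starting at row [o], one entry per pass. *)
Lemma exec_for2 (X o x y : nat) em en c s0 (F : nat -> nat -> R[i]) n :
  x != y -> x \notin widx c -> y \notin widx c ->
  let loop := For x em (For y en c) in
  (forall s, frame loop s0 s -> ieval (idx s) en = n) ->
  (forall i l s, (i < ieval (idx s0) em)%N -> (l < n)%N -> frame loop s0 s ->
     idx s x 0 = i -> idx s y 0 = l ->
     num s X (o + i)%N l = num s0 X (o + i)%N l ->
     forall i' l', num (run c s) X i' l' =
       if (i' == o + i)%N && (l' == l) then F i l else num s X i' l') ->
  forall i' l', num (run loop s0) X i' l' =
    if [&& o <= i', i' < o + ieval (idx s0) em & l' < n]%N
    then F (i' - o)%N l' else num s0 X i' l'.
Proof.
move=> xy xc yc loop en_n body.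
pose Inv i s := forall i' l', num s X i' l' =
  if [&& o <= i', i' < o + i & l' < n]%N then F (i' - o)%N l'
  else num s0 X i' l'.
apply: (@exec_for x em _ s0 Inv) => [i' l'|i s im fs IHs].
  by rewrite addn0 /=; case: (leqP o i').
set s1 := charge 1 _; have fs1 : frame loop s0 s1.
  by apply: frame_trans fs (frame_for_set_idx _ _ _ _ _).
pose Inv2 l s := forall i' l', num s X i' l' =
  if (i' == o + i)%N && (l' < l)%N then F i l' else num s1 X i' l'.
suff I2 : Inv2 n (run (For y en c) s1).
  move=> i' l'; rewrite I2 /s1 /= IHs addnS ltnS.
  have [->|i'i] := eqVneq i' (o + i)%N.
    rewrite leq_addr leqnn ltnn /= addKn.
    by case: ifP.
  by rewrite [(i' <= _)%N]leq_eqVlt (negbTE i'i).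
rewrite -(en_n s1 fs1); apply: exec_for => [i' l'|l s' ln fs' IHs'].
  by rewrite ltn0 andbF.
rewrite en_n // in ln.
set s2 := charge 1 _; have fs2 : frame (For y en c) s1 s2.
  by apply: frame_trans fs' (frame_for_set_idx _ _ _ _ _).
have fs02 : frame loop s0 s2.
  apply: frame_trans fs1 (frame_sub _ _ fs2) => // z /= zc.
  by rewrite inE zc orbT.
have s2x : idx s2 x 0 = i.
  by rewrite fs2.2 /= ?inE ?negb_or ?xy // /s1 /= !eqxx.
have s2y : idx s2 y 0 = l by rewrite /s2 /= !eqxx.
(* The entry about to be visited still has its initial value, which permits updates in place. *)
have s2X : num s2 X (o + i)%N l = num s0 X (o + i)%N l.
  rewrite -[LHS]/(num s' X _ _) IHs' ltnn andbF -[LHS]/(num s X _ _) IHs.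
  by rewrite ltnn /= andbF.
move=> i' l'; rewrite (body i l s2) // -[num s2 X _ _]/(num s' X i' l') IHs'.
have [->|_] /= := eqVneq i' (o + i)%N; last by [].
by rewrite ltnS [(l' <= l)%N]leq_eqVlt; case: eqP => [->|].
Qed.

Lemma run_seq c1 c2 s : run (Seq c1 c2) s = run c2 (run c1 s).
Proof. by []. Qed.

Definition scratch := Loc 20 (ICst 0) (ICst 0).

(** A Hermitian product, conjugating the second factor. *)
Definition dot acc x e a b :=
  Seq (Set_ acc (NCst 0))
    (For x e
      (Seq (Set_ scratch (NConj b))
        (Seq (Set_ scratch (NMul a scratch)) (Set_ acc (NAdd acc scratch))))).

Lemma exec_dot acc x e a b s :
  loc_mx acc != 20 -> loc_mx a \notin [:: 20; loc_mx acc] ->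
  loc_mx b \notin [:: 20; loc_mx acc] ->
  (forall i, ieval (idx (set_idx x 0 i s)) (loc_row acc) =
     ieval (idx s) (loc_row acc)) ->
  (forall i, ieval (idx (set_idx x 0 i s)) (loc_col acc) =
     ieval (idx s) (loc_col acc)) ->
  forall i' j', num (run (dot acc x e a b) s) (loc_mx acc) i' j' =
    if (i' == ieval (idx s) (loc_row acc)) &&
       (j' == ieval (idx s) (loc_col acc))
    then \sum_(i < ieval (idx s) e)
           fetch (set_idx x 0 i s) a * (fetch (set_idx x 0 i s) b)^*%R
    else num s (loc_mx acc) i' j'.
Proof.
case: acc => [Xc rc cc]; case: a b => [Xa ra ca] [Xb rb cb].
rewrite ![loc_mx _]/= ![loc_row _]/= ![loc_col _]/=.
rewrite !inE !negb_or => c20 /andP[a20 ac] /andP[b20 bc] rcE ccE.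
pose term i := fetch (set_idx x 0 i s) (Loc Xa ra ca) *
  (fetch (set_idx x 0 i s) (Loc Xb rb cb))^*%R.
(* First clause: the integers have changed at most at the counter, so addresses evaluate as in
   [s]. *)
pose Inv n s' := (forall i, idx (set_idx x 0 i s') = idx (set_idx x 0 i s)) /\
  forall i' j', num s' Xc i' j' =
   if (i' == ieval (idx s) rc) && (j' == ieval (idx s) cc)
    then \sum_(i < n) term i else num s Xc i' j'.
rewrite /dot run_seq; set s1 := run (Set_ _ _) s; set body := Seq _ _.
suff [_] : Inv (ieval (idx s1) e) (run (For x e body) s1) by apply.
apply: exec_for; first by split=> // i' j'; rewrite /= eqxx big_ord0.
move=> i s' _ [fn fi] [Ii In]; split.
  move=> i2; rewrite -Ii; apply/funext => y; apply/funext => j /=.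
  by case: (_ && _).
have nE X : X != 20 -> X != Xc -> num s' X = num s X.
  move=> X20 XXc; rewrite fn ?inE ?negb_or ?X20 ?XXc //.
  by apply/funext => i1; apply/funext => j1; rewrite /= (negbTE XXc).
move: Ii rcE ccE => /= Ii rcE ccE i' j'; rewrite /= eqxx ?(negbTE c20) /=.
rewrite /fetch /= !Ii !rcE !ccE !(negbTE a20) /=.
rewrite !In !eqxx [true && true]/= (nE Xa) // (nE Xb) // big_ord_recr.
by case: (_ && _).
Qed.

Lemma ieval_agree (ix ix' : nat -> nat -> nat) e :
  {in ivars e, forall x, ix x = ix' x} -> ieval ix e = ieval ix' e.
Proof.
elim: e => //= [x e IH|e1 IH1 e2 IH2|e1 IH1 e2 IH2] agr.
- rewrite agr ?inE ?eqxx // IH // => y ye; apply: agr.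
  by rewrite inE ye orbT.
- by rewrite IH1 ?IH2 // => y ye; apply: agr; rewrite mem_cat ye ?orbT.
- by rewrite IH1 ?IH2 // => y ye; apply: agr; rewrite mem_cat ye ?orbT.
Qed.

(** Arrays read by loop bounds lie outside [W] and never change, so every bound keeps its value in
    [ix]. *)
Lemma exec_static_cost W ix c s : fixed_bounds W c ->
  (forall x, x \notin W -> idx s x = ix x) ->
  [/\ forall x, x \notin W -> idx (run c s) x = ix x,
      (cost (run c s) <= cost s + static_cost ix c)%N &
      nsvd (run c s) = nsvd s].
Proof.
elim: c s => //=; first by move=> s; rewrite addn0.
- move=> c1 IH1 c2 IH2 s /andP[W1 W2].
  move=> /(IH1 _ W1)[/(IH2 _ W2)[i2 c2le n2] c1le n1].
  split=> //; last by rewrite n2.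
  by rewrite (leq_trans c2le) // addnA leq_add2r.
- move=> x e e' s xW ixs; split=> // y yW; rewrite -ixs //.
  by apply/funext => j; case: eqP xW yW => // -> ->.
- move=> a b c1 IH1 c2 IH2 s /andP[W1 W2] ixs; case: ifP => _.
    have [i1 c1le n1] := IH1 (charge 1 s) W1 ixs; split=> //.
    by move: c1le => /=; lia.
  have [i2 c2le n2] := IH2 (charge 1 s) W2 ixs; split=> //.
  by move: c2le => /=; lia.
- move=> a b c1 IH1 c2 IH2 s /andP[W1 W2] ixs; case: ifP => _.
    have [i1 c1le n1] := IH1 (charge 1 s) W1 ixs; split=> //.
    by move: c1le => /=; lia.
  have [i2 c2le n2] := IH2 (charge 1 s) W2 ixs; split=> //.
  by move: c2le => /=; lia.
- move=> x e c IH s /and3P[xW eW cW] ixs.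
  rewrite (@ieval_agree (idx s) ix) => [|y /(allP eW)]; last by exact: ixs.
  elim: (ieval ix e) => [|n [IHi IHc IHn]]; first by rewrite mul0n addn0.
  rewrite iteriS; set s1 := iteri _ _ _ in IHi IHc IHn *.
  have ixs1 y : y \notin W -> idx (charge 1 (set_idx x 0 n s1)) y = ix y.
    move=> yW; rewrite -IHi //; apply/funext => j /=.
    by case: eqP xW yW => // -> ->.
  have [i1 c1le n1] := IH _ cW ixs1; split=> //; last by rewrite n1.
  by apply: (leq_trans c1le) => /=; move: IHc; rewrite mulSn; lia.
Qed.

End Programs.

(* Storage.  Matrices: 0 is A, 3 the right singular vectors, 4 the stacked
   [V; E] with V in rows 0, ..., r - 1; rows 5 and 6 are the squared column
   norms of V and E, and 7, 8 their sums; 9 is the row g / |v|^2, 10 the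
   eliminated column, 11 the constant 1, 12 the product A V^*, 14 is never
   written and stays 0; 13, 15, 16 and 20 are temporaries.  Integers: 3 is the
   output, 4 the step, 5, 6, 7 are loop counters, 8 is the selected column. *)
Local Notation O0 := (ICst 0).
Local Notation vi := (IVar 5).
Local Notation vl := (IVar 6).
Local Notation vz := (IVar 7).
Local Notation sel := (IVar 8).
Local Notation loop2 em en c := (For 5 em (For 6 en c)).

Definition init_V := loop2 (IVar 2) (IVar 1)
  (Set_ (Loc 4 vi vl) (NConj (Loc 3 vl vi))).
Definition init_G := loop2 (IVar 0) (IVar 2)
  (dot (Loc 12 vi vl) 7 (IVar 1) (Loc 0 vi vz) (Loc 4 vl vz)).
Definition init_E := loop2 (IVar 0) (IVar 1)
  (Seq (dot (Loc 13 O0 O0) 7 (IVar 2) (Loc 12 vi vz) (Loc 3 vl vz))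
       (Set_ (Loc 4 (IAdd (IVar 2) vi) vl)
          (NSub (Loc 0 vi vl) (Loc 13 O0 O0)))).
Definition init_one := Set_ (Loc 11 O0 O0) (NCst 1).

(** Here and below, a loop with a single pass presents a vector as a matrix, so that [exec_for2]
    applies. *)
Definition V_norms := loop2 (ICst 1) (IVar 1)
  (dot (Loc 5 O0 vl) 7 (IVar 2) (Loc 4 vz vl) (Loc 4 vz vl)).
Definition E_norms := loop2 (ICst 1) (IVar 1)
  (dot (Loc 6 O0 vl) 7 (IVar 0)
     (Loc 4 (IAdd (IVar 2) vz) vl) (Loc 4 (IAdd (IVar 2) vz) vl)).
Definition total X Y :=
  dot (Loc X O0 O0) 7 (IVar 1) (Loc Y O0 vz) (Loc 11 O0 O0).
(** The first test rejects zero columns of [V]; the last index passing both tests is kept. *)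
Definition select := For 6 (IVar 1)
  (IfRe (Loc 5 O0 vl) (Loc 14 O0 O0) Skip
    (Seq (Set_ (Loc 15 O0 O0) (NMul (Loc 7 O0 O0) (Loc 6 O0 vl)))
    (Seq (Set_ (Loc 16 O0 O0) (NMul (Loc 8 O0 O0) (Loc 5 O0 vl)))
    (IfRe (Loc 15 O0 O0) (Loc 16 O0 O0) (ISet 8 O0 vl) Skip)))).
Definition coefs := loop2 (ICst 1) (IVar 1)
  (Seq (dot (Loc 13 O0 O0) 7 (IVar 2) (Loc 4 vz vl) (Loc 4 vz sel))
       (Set_ (Loc 9 O0 vl) (NDiv (Loc 13 O0 O0) (Loc 5 O0 sel)))).
(** The pivot column is saved because [update] overwrites it while later columns still need it. *)
Definition copy_col := loop2 (IAdd (IVar 2) (IVar 0)) (ICst 1)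
  (Set_ (Loc 10 vi vl) (NCopy (Loc 4 vi sel))).
Definition update := loop2 (IAdd (IVar 2) (IVar 0)) (IVar 1)
  (Seq (Set_ (Loc 13 O0 O0) (NMul (Loc 10 vi O0) (Loc 9 O0 vl)))
       (Set_ (Loc 4 vi vl) (NSub (Loc 4 vi vl) (Loc 13 O0 O0)))).

(** * What each piece of the program computes *)

Section Spec.
Local Open Scope sesquilinear_scope.
Local Open Scope complex_scope.
Variables (R : realType)
  (svd : forall m n : nat, 'M[R[i]]_(m, n) -> svd_triple R m n) (csvd : nat).
Implicit Types (s : state R).
Local Notation run := (exec svd csvd).

Lemma V_norms_spec s l : (l < idx s 1 0)%N ->
  num (run V_norms s) 5 0%N l =
  \sum_(i < idx s 2 0) num s 4 i l * (num s 4 i l)^*%R.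
Proof.
move=> lN; rewrite (@exec_for2 _ svd csvd 5 0 5 6 _ _ _ s
  (fun _ l => \sum_(i < idx s 2 0) num s 4 i l * (num s 4 i l)^*%R)
  (idx s 1 0)) //.
- by rewrite /= lN.
- by move=> s' [_ fi]; rewrite /= fi.
move=> i l1 s' i0 _ [fn fi] _ s'6 _ i' l'.
rewrite (@exec_dot R svd csvd (Loc 5 O0 vl)) //=.
rewrite s'6 fi // fn //.
by move: i0; case: i.
Qed.

Lemma E_norms_spec s l : (l < idx s 1 0)%N ->
  num (run E_norms s) 6 0%N l =
  \sum_(i < idx s 0 0)
     num s 4 (idx s 2 0 + i)%N l * (num s 4 (idx s 2 0 + i)%N l)^*%R.
Proof.
move=> lN; rewrite (@exec_for2 _ svd csvd 6 0 5 6 _ _ _ s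
  (fun _ l => \sum_(i < idx s 0 0)
     num s 4 (idx s 2 0 + i)%N l * (num s 4 (idx s 2 0 + i)%N l)^*%R)
  (idx s 1 0)) //.
- by rewrite /= lN.
- by move=> s' [_ fi]; rewrite /= fi.
move=> i l1 s' i0 _ [fn fi] _ s'6 _ i' l'.
rewrite (@exec_dot R svd csvd (Loc 6 O0 vl)) //=.
rewrite s'6 (fi 0%N) // (fi 2%N) // fn //.
by move: i0; case: i.
Qed.

Lemma total_spec X Y s :
  X \notin [:: 20; Y; 11] -> Y != 20 -> num s 11 0%N 0%N = 1 ->
  num (run (total X Y) s) X 0%N 0%N = \sum_(l < idx s 1 0) num s Y 0%N l.
Proof.
rewrite !inE !negb_or => /and3P[X20 XY X11] Y20 one.
rewrite (@exec_dot R svd csvd (Loc X O0 O0)) //= ?inE ?negb_or ?Y20 1?eq_sym //.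
  by apply: eq_bigr => i _; rewrite /fetch /= one conjC1 mulr1.
by rewrite [11 == X]eq_sym X11.
Qed.

Definition eligible s l :=
  ~~ (complex.Re (num s 5 0%N l) <= complex.Re (num s 14 0%N 0%N)) &&
  (complex.Re (num s 7 0%N 0%N * num s 6 0%N l)
     <= complex.Re (num s 8 0%N 0%N * num s 5 0%N l)).

Lemma select_spec s : (exists2 l, (l < idx s 1 0)%N & eligible s l) ->
  (idx (run select s) 8 0 < idx s 1 0)%N && eligible s (idx (run select s) 8 0).
Proof.
(* Nothing is claimed before the first eligible index; from then on the stored index is eligible. *)
pose Inv n s' := (exists2 l, (l < n)%N & eligible s l) ->
  (idx s' 8 0 < idx s 1 0)%N && eligible s (idx s' 8 0).
suff : Inv (idx s 1 0) (run select s) by [].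
apply: (@exec_for _ svd csvd 6 (IVar 1)); first by case.
move=> i s' iN [fn fi] IHs' [l].
have nE X : X \notin [:: 15; 16] -> num s' X = num s X by move=> ?; apply: fn.
have elE : eligible s i =
  ~~ (complex.Re (num s' 5 0%N i) <= complex.Re (num s' 14 0%N 0%N)) &&
  (complex.Re (num s' 7 0%N 0%N * num s' 6 0%N i)
     <= complex.Re (num s' 8 0%N 0%N * num s' 5 0%N i)) by rewrite !nE.
rewrite ltnS leq_eqVlt => li el.
have IHs'' : ~~ eligible s i ->
    (idx s' 8 0 < idx s 1 0)%N && eligible s (idx s' 8 0).
  move=> nel; apply: IHs'; exists l => //.
  by case/predU1P: li el nel => [->|//] ->.
rewrite /= /fetch /=; case: ifP => /= [c1|/negbT c1].
  by apply: IHs''; rewrite elE c1.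
rewrite /fetch /=; case: ifP => /= [c2|/negbT c2].
  by rewrite iN elE c1 c2.
by apply: IHs''; rewrite elE (negbTE c2) andbF.
Qed.

Lemma coefs_spec s l : (l < idx s 1 0)%N ->
  num (run coefs s) 9 0%N l =
  (\sum_(i < idx s 2 0) num s 4 i l * (num s 4 i (idx s 8 0))^*%R)
     / num s 5 0%N (idx s 8 0).
Proof.
move=> lN; rewrite (@exec_for2 _ svd csvd 9 0 5 6 _ _ _ s
  (fun _ l => (\sum_(i < idx s 2 0) num s 4 i l * (num s 4 i (idx s 8 0))^*%R)
     / num s 5 0%N (idx s 8 0)) (idx s 1 0)) //.
- by rewrite /= lN.
- by move=> s' [_ fi]; rewrite /= fi.
move=> i l1 s' i0 _ [fn fi] _ s'6 _ i' l'; rewrite run_seq.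
set d := dot _ _ _ _ _; have [dn di] := exec_frame svd csvd d s'.
have := @exec_dot R svd csvd (Loc 13 O0 O0) 7 (IVar 2)
  (Loc 4 vz vl) (Loc 4 vz sel) s'.
rewrite -/d => /(_ isT isT isT (fun=> erefl) (fun=> erefl) 0%N 0%N) /= dE.
rewrite /fetch /= dE di // di // s'6 dn // dn //= (fn 5%N) //.
rewrite (fi 8%N) // (fi 2%N) // /fetch /= ?s'6 (fn 4%N) // ?(fi 8%N) //.
by case: i i0.
Qed.

Lemma copy_col_spec s i : (i < idx s 2 0 + idx s 0 0)%N ->
  num (run copy_col s) 10 i 0%N = num s 4 i (idx s 8 0).
Proof.
move=> ib; rewrite (@exec_for2 _ svd csvd 10 0 5 6 _ _ _ s
  (fun i _ => num s 4 i (idx s 8 0)) 1) //.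
  by rewrite /= ib subn0.
move=> i1 l s' _ _ [fn fi] s'5 s'6 _ i' l'.
by rewrite /= /fetch /= s'5 s'6 (fn 4%N) // (fi 8%N).
Qed.

Lemma update_spec s i l : (i < idx s 2 0 + idx s 0 0)%N -> (l < idx s 1 0)%N ->
  num (run update s) 4 i l = num s 4 i l - num s 10 i 0%N * num s 9 0%N l.
Proof.
move=> ib lb; rewrite (@exec_for2 _ svd csvd 4 0 5 6 _ _ _ s
  (fun i l => num s 4 i l - num s 10 i 0%N * num s 9 0%N l) (idx s 1 0)) //.
- by rewrite /= ib lb subn0.
- by move=> s' [_ fi]; rewrite /= fi.
move=> i1 l1 s' _ _ [fn fi] s'5 s'6; rewrite add0n => s'4 i' l'.
by rewrite /= /fetch /= s'5 s'6 (fn 10%N) // (fn 9%N) // s'4.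
Qed.

Lemma init_V_spec s i l : (i < idx s 2 0)%N -> (l < idx s 1 0)%N ->
  num (run init_V s) 4 i l = (num s 3 l i)^*%R.
Proof.
move=> ib lb; rewrite (@exec_for2 _ svd csvd 4 0 5 6 _ _ _ s
  (fun i l => (num s 3 l i)^*%R) (idx s 1 0)) //.
- by rewrite /= ib lb subn0.
- by move=> s' [_ fi]; rewrite /= fi.
move=> i1 l1 s' _ _ [fn fi] s'5 s'6 _ i' l'.
by rewrite /= /fetch /= s'5 s'6 (fn 3%N).
Qed.

Lemma init_G_spec s i l : (i < idx s 0 0)%N -> (l < idx s 2 0)%N ->
  num (run init_G s) 12 i l =
  \sum_(k < idx s 1 0) num s 0 i k * (num s 4 l k)^*%R.
Proof.
move=> ib lb; rewrite (@exec_for2 _ svd csvd 12 0 5 6 _ _ _ s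
  (fun i l => \sum_(k < idx s 1 0) num s 0 i k * (num s 4 l k)^*%R)
  (idx s 2 0)) //.
- by rewrite /= ib lb subn0.
- by move=> s' [_ fi]; rewrite /= fi.
move=> i1 l1 s' _ _ [fn fi] s'5 s'6 _ i' l'.
rewrite (@exec_dot R svd csvd (Loc 12 vi vl)) //=.
by rewrite s'5 s'6 fi // /fetch /= ?s'5 ?s'6 (fn 4%N) // (fn 0%N).
Qed.

(** The unchanged entries are included because [V] occupies the upper rows of the same matrix. *)
Lemma init_E_spec s i l :
  num (run init_E s) 4 i l =
  if [&& idx s 2 0 <= i, i < idx s 2 0 + idx s 0 0 & l < idx s 1 0]%N
  then num s 0 (i - idx s 2 0)%N l -
    \sum_(k < idx s 2 0) num s 12 (i - idx s 2 0)%N k * (num s 3 l k)^*%R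
  else num s 4 i l.
Proof.
rewrite (@exec_for2 _ svd csvd 4 (idx s 2 0) 5 6 _ _ _ s
  (fun i l => num s 0 i l -
     \sum_(k < idx s 2 0) num s 12 i k * (num s 3 l k)^*%R) (idx s 1 0)) //.
  by move=> s' [_ fi]; rewrite /= fi.
move=> i1 l1 s' _ _ [fn fi] s'5 s'6 _ i' l'; rewrite run_seq.
set d := dot _ _ _ _ _; have [dn di] := exec_frame svd csvd d s'.
have := @exec_dot R svd csvd (Loc 13 O0 O0) 7 (IVar 2)
  (Loc 12 vi vz) (Loc 3 vl vz) s'.
rewrite -/d => /(_ isT isT isT (fun=> erefl) (fun=> erefl) 0%N 0%N) /= dE.
rewrite /fetch /= dE di // di // di // s'5 s'6 dn // dn //= (fn 0%N) //.
by rewrite (fi 2%N) // /fetch /= ?s'5 ?s'6 (fn 12%N) // (fn 3%N).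
Qed.

End Spec.

Definition greedy_body :=
  Seq V_norms (Seq E_norms (Seq (total 7 5) (Seq (total 8 6) (Seq select
    (Seq (ISet 3 (IVar 4) sel) (Seq coefs (Seq copy_col update))))))).

Definition initialize := Seq init_V (Seq init_G (Seq init_E init_one)).

Definition greedy_loop := For 4 (IVar 2) greedy_body.

Definition find_columns :=
  Seq (CallSVD 0 (IVar 0) (IVar 1) 1 2 3) (Seq initialize greedy_loop).

(** * Correctness and cost of the whole program *)

Section Correctness.
Local Open Scope sesquilinear_scope.
Local Open Scope complex_scope.
Variables (R : realType)
  (svd : forall m n : nat, 'M[R[i]]_(m, n) -> svd_triple R m n) (csvd : nat).
Implicit Types (s : state R).
Local Notation run := (exec svd csvd).

Lemma notin_all (x : nat) (W W' : seq nat) :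
  x \notin W -> all [in W] W' -> x \notin W'.
Proof. by move=> xW /allP sub; apply: contra xW; apply: sub. Qed.

Definition upper r N s : 'M[R[i]]_(r, N) := \matrix_(i, j) num s 4 i j.
Definition lower r M N s : 'M[R[i]]_(M, N) :=
  \matrix_(i, j) num s 4 (r + i)%N j.

(** Programs compare only real parts; products of nonnegative numbers are real, so nothing is
    lost. *)
Lemma ReM_le (a b c d : R[i]) : 0 <= a -> 0 <= b -> 0 <= c -> 0 <= d ->
  (complex.Re (a * b) <= complex.Re (c * d)) = (a * b <= c * d).
Proof.
move=> a0 b0 c0 d0; have := mulr_ge0 a0 b0; have := mulr_ge0 c0 d0.
case: (a * b) (c * d) => [x1 y1] [x2 y2].
by rewrite !lecE /= => /andP[/eqP-> _] /andP[/eqP-> _]; rewrite eqxx.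
Qed.

Lemma greedy_body_spec r M N k s :
  idx s 0 0 = M -> idx s 1 0 = N -> idx s 2 0 = r -> idx s 4 0 = k ->
  num s 11 0%N 0%N = 1 -> num s 14 0%N 0%N = 0 ->
  let V := upper r N s in let E := lower r M N s in
  (exists2 j, 0 < frob (col j V) &
     frob V * frob (col j E) <= frob E * frob (col j V)) ->
  let s' := run greedy_body s in
  exists j : 'I_N, [/\ 0 < frob (col j V) &
     frob V * frob (col j E) <= frob E * frob (col j V)] /\
    [/\ idx s' 3 k = j, (forall t, t != k -> idx s' 3 t = idx s 3 t),
      upper r N s' = deflate V j V & lower r M N s' = deflate V j E].
Proof.
move=> sM sN sr sk one zero V E ex.
rewrite /greedy_body (run_seq svd csvd V_norms) (run_seq svd csvd E_norms).
rewrite (run_seq svd csvd (total 7 5)) (run_seq svd csvd (total 8 6)).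
rewrite (run_seq svd csvd select) (run_seq svd csvd (ISet _ _ _)).
rewrite (run_seq svd csvd coefs) (run_seq svd csvd copy_col).
have [n1 i1] := exec_frame svd csvd V_norms s.
have p1 (l : 'I_N) : num (run V_norms s) 5 0%N l = frob (col l V).
  rewrite V_norms_spec ?sN // sr frobE; apply: eq_bigr => i _.
  by rewrite big_ord1 !mxE.
move: (run V_norms s) n1 i1 p1 => s1 n1 i1 p1.
have [n2 i2] := exec_frame svd csvd E_norms s1.
have e2 (l : 'I_N) : num (run E_norms s1) 6 0%N l = frob (col l E).
  rewrite E_norms_spec ?i1 ?sN // sM sr frobE; apply: eq_bigr => i _.
  by rewrite big_ord1 !mxE n1.
move: (run E_norms s1) n2 i2 e2 => s2 n2 i2 e2.
have [n3 i3] := exec_frame svd csvd (total 7 5) s2.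
have t3 : num (run (total 7 5) s2) 7 0%N 0%N = frob V.
  rewrite total_spec //; last by rewrite n2 // n1.
  rewrite i2 // i1 // sN frob_col_sum.
  by apply: eq_bigr => l _; rewrite n2 // p1.
move: (run (total 7 5) s2) n3 i3 t3 => s3 n3 i3 t3.
have [n4 i4] := exec_frame svd csvd (total 8 6) s3.
have t4 : num (run (total 8 6) s3) 8 0%N 0%N = frob E.
  rewrite total_spec //; last by rewrite n3 // n2 // n1.
  rewrite i3 // i2 // i1 // sN frob_col_sum.
  by apply: eq_bigr => l _; rewrite n3 // e2.
move: (run (total 8 6) s3) n4 i4 t4 => s4 n4 i4 t4.
have idx4 x : x \notin [:: 5; 6; 7] -> idx s4 x = idx s x.
  move=> xW; rewrite i4 ?(notin_all xW) // i3 ?(notin_all xW) //.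
  by rewrite i2 ?(notin_all xW) // i1 ?(notin_all xW).
(* The two tests of the program are exactly the selection rule of the greedy step. *)
have eligE (l : 'I_N) : eligible s4 l =
    (0 < frob (col l V)) &&
    (frob V * frob (col l E) <= frob E * frob (col l V)).
  rewrite /eligible t4 (n4 7%N) // t3 (n4 5%N) // n3 // n2 // p1 (n4 6%N) //.
  rewrite n3 // e2 n4 // n3 // n2 // n1 // zero ReM_le ?frob_ge0 //.
  congr (_ && _); have := frob_ge0 (col l V).
  case: (frob _) => x y; rewrite lecE ltcE /= => /andP[-> _] /=.
  by rewrite -ltNge.
have [n5 i5] := exec_frame svd csvd select s4.
have /(select_spec svd csvd) : exists2 l, (l < idx s4 1 0)%N & eligible s4 l.
  have [j pj cj] := ex; exists j; first by rewrite idx4 // sN.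
  by rewrite eligE pj.
move: (run select s4) n5 i5 => s5 n5 i5.
rewrite idx4 // sN => /andP[jN].
set j := Ordinal jN; rewrite -[idx s5 8 0]/(nat_of_ord j) eligE => /andP[pj cj].
exists j; split; first by split.
set s6 := run (ISet _ _ _) s5.
have s6num : num s6 = num s5 by [].
have s6idx x : x != 3%N -> idx s6 x = idx s5 x.
  by move=> x3; apply/funext => t; rewrite /s6 /= (negbTE x3).
have s6out t : idx s6 3 t = if t == k then j : nat else idx s 3 t.
  by rewrite /s6 /= (i5 4%N) // (i5 3%N) // !idx4 // sk.
move: s6 s6num s6idx s6out => s6 s6num s6idx s6out.
have [n7 i7] := exec_frame svd csvd coefs s6.
have c7 (l : 'I_N) : num (run coefs s6) 9 0%N l =
    (frob (col j V))^-1 * pivot_row V j 0 l.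
  have s4B : num s5 4 = num s 4 by rewrite n5 // n4 // n3 // n2 // n1.
  rewrite coefs_spec; last by rewrite s6idx // i5 // idx4 // sN.
  rewrite s6num s6idx // s6idx // i5 // idx4 // sr s4B.
  rewrite -[idx s5 8 0]/(nat_of_ord j) n5 // n4 // n3 // n2 // p1 mulrC.
  by congr (_ * _); rewrite mxE; apply: eq_bigr => i _; rewrite !mxE mulrC.
move: (run coefs s6) n7 i7 c7 => s7 n7 i7 c7.
have [n8 i8] := exec_frame svd csvd copy_col s7.
(* Matrix 4 is untouched until [update], so all computed quantities refer to the old [V] and [E]. *)
have num4 : num s7 4 = num s 4.
  by rewrite n7 // s6num n5 // n4 // n3 // n2 // n1.
have idx7 x : x \notin [:: 3; 5; 6; 7; 8] -> idx s7 x = idx s x.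
  move=> xW; have x3 : x != 3%N.
    by have := notin_all (W' := [:: 3]) xW isT; rewrite inE.
  rewrite i7 ?(notin_all xW) // s6idx // i5 ?(notin_all xW) //.
  by rewrite idx4 // (notin_all xW).
have c8 i : (i < r + M)%N -> num (run copy_col s7) 10 i 0%N = num s 4 i j.
  move=> ir; rewrite copy_col_spec; last by rewrite !idx7 // sr sM.
  by rewrite num4 i7 // s6idx.
move: (run copy_col s7) n8 i8 c8 => s8 n8 i8 c8.
have [n9 i9] := exec_frame svd csvd update s8.
have u9 i (l : 'I_N) : (i < r + M)%N -> num (run update s8) 4 i l =
    num s 4 i l - num s 4 i j * ((frob (col j V))^-1 * pivot_row V j 0 l).
  move=> ir; rewrite update_spec; last first.
  - by rewrite i8 // idx7 // sN.
  - by rewrite !i8 // !idx7 // sr sM.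
  by rewrite n8 // num4 c8 // n8 // c7.
move: (run update s8) n9 i9 u9 => s9 n9 i9 u9.
have out9 t : idx s9 3 t = if t == k then j : nat else idx s 3 t.
  by rewrite i9 // i8 // i7 // s6out.
split; first by rewrite out9 eqxx.
- by move=> t /negbTE tk; rewrite out9 tk.
- apply/matrixP => i l; rewrite !mxE big_ord1 !mxE u9 ?ltn_addr // mulrCA.
  by congr (_ - _ * (_ * _)); rewrite mxE.
- apply/matrixP => i l; rewrite !mxE big_ord1 !mxE u9 ?ltn_add2l // mulrCA.
  by congr (_ - _ * (_ * _)); rewrite mxE.
Qed.

(** The loop invariant is [greedy], with integer array 3 as [J] and the two blocks of matrix 4 as
    [V] and [E]. *)
Lemma greedy_loop_spec r M N (V0 : 'M[R[i]]_(r, N)) (E0 : 'M[R[i]]_(M, N)) s :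
  idx s 0 0 = M -> idx s 1 0 = N -> idx s 2 0 = r ->
  num s 11 0%N 0%N = 1 -> num s 14 0%N 0%N = 0 ->
  upper r N s = V0 -> lower r M N s = E0 ->
  V0 *m V0^t* = 1%:M -> E0 *m V0^t* = 0 ->
  let s' := run greedy_loop s in
  greedy V0 E0 r (idx s' 3) (upper r N s') (lower r M N s').
Proof.
move=> sM sN sr one zero <- <- {V0 E0} VV EV.
set V0 := upper r N s in VV EV *; set E0 := lower r M N s in EV *.
pose Inv k s' := greedy V0 E0 k (idx s' 3) (upper r N s') (lower r M N s').
have : Inv (idx s 2 0) (run greedy_loop s); last by rewrite sr.
apply: (@exec_for _ svd csvd 4 (IVar 2)) => [|k s' kr [fn fi] gr].
  exact: greedy_init.
rewrite [ieval _ _]sr in kr; set s1 := charge 1 (set_idx 4 0 k s').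
have idx1 x : x != 4%N -> idx s1 x = idx s' x.
  by move=> x4; apply/funext => t; rewrite /s1 /= (negbTE x4).
have ex : exists2 j, 0 < frob (col j (upper r N s1)) &
    frob (upper r N s1) * frob (col j (lower r M N s1))
      <= frob (lower r M N s1) * frob (col j (upper r N s1)).
  by have [j pj cj] := greedy_select gr kr; exists j.
have s1M : idx s1 0 0 = M by rewrite idx1 // fi.
have s1N : idx s1 1 0 = N by rewrite idx1 // fi.
have s1r : idx s1 2 0 = r by rewrite idx1 // fi.
have s1one : num s1 11 0%N 0%N = 1 by rewrite -one -[num s1 11]/(num s' 11) fn.
have s1zero : num s1 14 0%N 0%N = 0.
  by rewrite -zero -[num s1 14]/(num s' 14) fn.
have [j [[pj cj] [outk out up lo]]] :=
  greedy_body_spec s1M s1N s1r (erefl : idx s1 4 0 = k) s1one s1zero ex.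
rewrite /Inv up lo; apply: (greedy_step gr kr pj cj) => // t tk.
by rewrite out ?idx1 // neq_ltn tk.
Qed.

Lemma initialize_spec r M N (A : 'M[R[i]]_(M, N)) (W : 'M[R[i]]_(N, r)) s :
  idx s 0 0 = M -> idx s 1 0 = N -> idx s 2 0 = r ->
  (forall (i : 'I_M) (j : 'I_N), num s 0 i j = A i j) ->
  (forall (i : 'I_N) (j : 'I_r), num s 3 i j = W i j) ->
  let s' := run initialize s in
  upper r N s' = W^t* /\ lower r M N s' = A - A *m W *m W^t*.
Proof.
move=> sM sN sr AE WE.
rewrite /initialize (run_seq svd csvd init_V) (run_seq svd csvd init_G).
rewrite (run_seq svd csvd init_E).
have [n1 i1] := exec_frame svd csvd init_V s.
have V1 (i : 'I_r) (l : 'I_N) : num (run init_V s) 4 i l = (W l i)^*%R.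
  by rewrite init_V_spec ?sr ?sN // WE.
move: (run init_V s) n1 i1 V1 => s1 n1 i1 V1.
have [n2 i2] := exec_frame svd csvd init_G s1.
(* The stored [V] is [W^*] and [dot] conjugates again, which leaves [A *m W]. *)
have G2 (i : 'I_M) (k : 'I_r) : num (run init_G s1) 12 i k = (A *m W) i k.
  rewrite init_G_spec ?i1 ?sM ?sr // sN mxE; apply: eq_bigr => l _.
  by rewrite n1 // AE V1 conjCK.
move: (run init_G s1) n2 i2 G2 => s2 n2 i2 G2.
have i2r : idx s2 2 0 = r by rewrite i2 ?i1.
have upE (i : 'I_r) l : num (run init_E s2) 4 i l = num s2 4 i l.
  by rewrite init_E_spec i2r leqNgt ltn_ord.
have loE (i : 'I_M) (l : 'I_N) : num (run init_E s2) 4 (r + i)%N l =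
    A i l - (A *m W *m W^t*) i l.
  rewrite init_E_spec i2r leq_addr ltn_add2l addKn ?i2 ?i1 // sM sN !ltn_ord.
  rewrite n2 // n1 // AE mxE; congr (_ - _); apply: eq_bigr => k _.
  by rewrite G2 n2 // n1 // WE !mxE.
have [n4 i4] := exec_frame svd csvd init_one (run init_E s2).
split; apply/matrixP => i l; rewrite !mxE n4 //.
  by rewrite upE n2 // V1.
by rewrite loE !mxE.
Qed.

Lemma run_svd_spec M N (A : 'M[R[i]]_(M, N)) r :
  let s := run (CallSVD 0 (IVar 0) (IVar 1) 1 2 3) (init_state A r) in
  [/\ idx s = idx (init_state A r),
     forall i j, num s 0 (nat_of_ord i) (nat_of_ord j) = A i j,
     forall i j, num s 3 (nat_of_ord i) (nat_of_ord j) = svd_right (svd A) i j,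
     forall X i j, (3 < X)%N -> num s X i j = 0 &
     nsvd s = 1%N /\ cost s = (csvd * (minn M N * M * N))%N].
Proof.
rewrite -[run _ _]/(run_svd svd csvd M N 0 1 2 3 (init_state A r)).
have readE : read_mx M N 0 (init_state A r) = A.
  by apply/matrixP => i j; rewrite mxE /= !valK.
rewrite /run_svd readE; split=> //.
- by move=> i j; rewrite /= !valK.
- by move=> i j; rewrite /= !valK.
- by move=> [|[|[|[|X]]]].
Qed.

(** Each monomial of the cost is at most [q * M * N], since [r <= q <= M]; 200 dominates the sum of
    the coefficients. *)
Lemma static_costs ix q :
  (0 < q)%N -> (q <= ix 0 0)%N -> (q <= ix 1 0)%N -> (ix 2 0 <= q)%N ->
  (static_cost ix (Seq initialize greedy_loop)
     <= 200 * (q * ix 0 0 * ix 1 0))%N.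
Proof.
move=> q0 qM qN rq /=.
move: (ix 0 0) (ix 1 0) (ix 2 0) qM qN rq => M N r qM qN rq.
set P := (q * M * N)%N.
have le_P a b c : (a <= q -> b <= M -> c <= N -> a * b * c <= P)%N.
  by move=> aq bM cN; rewrite !leq_mul.
have M0 : (0 < M)%N by apply: leq_trans qM.
have N0 : (0 < N)%N by apply: leq_trans qN.
have rM : (r <= M)%N by apply: leq_trans qM.
have := le_P 1%N 1%N 1%N q0 M0 N0; have := le_P 1%N M 1%N q0 (leqnn M) N0.
have := le_P r 1%N 1%N rq M0 N0; have := le_P r r 1%N rq rM N0.
have := le_P r 1%N N rq M0 (leqnn N); have := le_P r r N rq rM (leqnn N).
have := le_P r M 1%N rq (leqnn M) N0; have := le_P r M N rq (leqnn M) (leqnn N).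
have := le_P 1%N M N q0 (leqnn M) (leqnn N).
clear le_P; clearbody P; clear -P; rewrite !(mul1n, muln1); lia.
Qed.

Lemma find_columns_spec :
  (forall m n (B : 'M[R[i]]_(m, n)), is_svd B (svd B)) ->
  forall M N (A : 'M[R[i]]_(M, N)) r (Ar : 'M[R[i]]_(M, N)),
  (0 < M)%N -> (0 < N)%N -> is_truncated_svd r A Ar -> \rank Ar = r ->
  let out := run find_columns (init_state A r) in
  [/\ nsvd out = 1%N,
      (cost out <= (csvd + 200) * (minn M N * M * N))%N &
      exists J : 'I_r -> 'I_N,
        [/\ injective J,
            returns_columns out J &
            let C := colsub J A in
            fnorm (A - C *m mp_pinv C *m A)
              <= Num.sqrt r.+1%:R * fnorm (A - Ar)]].
Proof.
move=> svdP M N A r Ar M0 N0 [D Dsvd ->] rankAr.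
(* The rank hypothesis ensures that [r] singular vectors are available. *)
have rq : (r <= minn M N)%N.
  by rewrite leq_min -{1 2}rankAr rank_leq_row rank_leq_col.
rewrite /find_columns (run_seq svd csvd (CallSVD _ _ _ _ _ _)).
have [s_idx sA sV s0 [s_nsvd s_cost]] := run_svd_spec A r.
move: (run (CallSVD _ _ _ _ _ _) _) s_idx sA sV s0 s_nsvd s_cost.
move=> s s_idx sA sV s0 s_nsvd s_cost.
have [sM [sN sr]] : idx s 0 0 = M /\ idx s 1 0 = N /\ idx s 2 0 = r.
  by rewrite s_idx.
have [_ cost_le nsvdE] := @exec_static_cost R svd csvd [:: 3; 4; 5; 6; 7; 8]
  (idx s) (Seq initialize greedy_loop) s isT (fun _ _ => erefl).
split; first by rewrite nsvdE.
  apply: leq_trans cost_le _; rewrite s_cost mulnDl leq_add2l -{2}sM -{2}sN.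
  apply: (@static_costs (idx s)); rewrite ?sM ?sN ?sr ?geq_minl ?geq_minr //.
  by rewrite leq_min M0 N0.
set W := leading (svd A) rq.
have WW : W^t* *m W = 1%:M.
  by apply: colsub_ortho; case: (svdP _ _ A).
rewrite (run_seq svd csvd initialize).
have [upE loE] : upper r N (run initialize s) = W^t* /\
    lower r M N (run initialize s) = A - A *m W *m W^t*.
  by apply: initialize_spec => // i j; rewrite [RHS]mxE -sV.
have [ni ii] := exec_frame svd csvd initialize s.
have one1 s1 : num (run init_one s1) 11 0%N 0%N = 1 by [].
have one : num (run initialize s) 11 0%N 0%N = 1.
  rewrite /initialize (run_seq svd csvd init_V) (run_seq svd csvd init_G).
  by rewrite (run_seq svd csvd init_E) one1.
have gr := greedy_loop_spec (etrans (congr1 (@^~ 0%N) (ii 0%N isT)) sM)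
  (etrans (congr1 (@^~ 0%N) (ii 1%N isT)) sN)
  (etrans (congr1 (@^~ 0%N) (ii 2%N isT)) sr) one
  (etrans (congr1 (fun f => f 0%N 0%N) (ni 14%N isT)) (s0 14%N 0%N 0%N isT))
  upE loE.
rewrite trmxCK mulmxBl -(mulmxA (A *m W)) WW mulmx1 subrr in gr.
have {gr} := gr erefl erefl.
move: (run greedy_loop _) => out gr.
pose J (t : 'I_r) : 'I_N := Ordinal (greedy_range gr (ltn_ord t)).
exists J; split=> //.
  move=> t u /(congr1 val) /= tu; apply: val_inj.
  exact: (greedy_inj gr (ltn_ord t) (ltn_ord u)).
apply: fnorm_le.
have := @greedy_final _ r M N A (W^t*); rewrite trmxCK.
move=> /(_ _ _ _ J gr (fun=> erefl)) /le_trans; apply.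
(* The bound obtained concerns the truncation from [svd A]; it remains to pass to the given one. *)
rewrite ler_wpM2r ?ler0n // -(truncation_proj rq (svdP _ _ A)).
exact: truncation_error_le (svdP _ _ A) Dsvd.
Qed.

End Correctness.

Theorem corollary1 (R : realType) :
  exists p : cmd, forall csvd : nat, exists K : nat,
  forall svd : (forall m n : nat, 'M[R[i]]_(m, n) -> svd_triple R m n),
  (forall (m n : nat) (B : 'M[R[i]]_(m, n)), is_svd B (svd m n B)) ->
  forall (M N : nat) (A : 'M[R[i]]_(M, N)) (r : nat) (Ar : 'M[R[i]]_(M, N)),
  (0 < M)%N -> (0 < N)%N ->
  is_truncated_svd r A Ar -> \rank Ar = r ->
  let out := exec svd csvd p (init_state A r) in
  [/\ nsvd out = 1%N,
      (cost out <= K * (minn M N * M * N))%N &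
      exists J : 'I_r -> 'I_N,
        [/\ injective J,
            returns_columns out J &
            let C := colsub J A in
            fnorm (A - C *m mp_pinv C *m A)
              <= Num.sqrt r.+1%:R * fnorm (A - Ar)]].
Proof.
(* [csvd] pays for the decomposition and 200 for all other operations. *)
exists find_columns => csvd; exists (csvd + 200)%N => svd.
exact: find_columns_spec.
Qed.
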